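(* Let $\Omega$, $\mathbf A$, the family of finite element spaces $\mathring{\mathbb V}_h(\Omega)\subset\mathbb V_h(\Omega)$ (satisfying the generalized quasiuniformity conditions with mesh parameter $h$) and the constants $c_\circ,\hat c_{1,2}$ be as described in the context. For $\sigma\ge0$ and $f\in L_2(\Omega)$ let $u$ be the weak solution of $-\mathrm{div}(\mathbf A\nabla u)+\sigma u=f$ in $\Omega$, $u|_{\partial\Omega}=0$, and let $u_{\mathrm{fem}}\in\mathring{\mathbb V}_h(\Omega)$ be its finite element (Galerkin) solution. Suppose that the following convergence estimates hold with constants $c_{k,l}$ independent of $\sigma,h,f$: $$\|u-u_{\mathrm{fem}}\|_{k,\Omega}\le c_{k,l}h^{l-k}\|u\|_{l,\Omega},\quad k=0,1,\ l=1,2,$$ $$\|u-u_{\mathrm{fem}}\|_{0,\Omega}\le\min[\,c_\circ c_{0,2}h^2,\ \sigma^{-1}\,]\,\|f\|_{0,\Omega},\quad\forall\,\sigma\ge0$$ (with $\sigma^{-1}=+\infty$ for $\sigma=0$). Let $\widetilde{\mathbf z}$ be a recovery operator that produces from the finite element flux $-\mathbf A\nabla\phi$, $\phi\in\mathbb V_h(\Omega)$, a vector-function $\widetilde{\mathbf z}(\phi)\in\mathbf H(\Omega,\mathrm{div})$ such that, with constants $\hat c,\hat c_1,\hat c_2$ independent of $\sigma,h,f$, $$\|\widetilde{\mathbf z}(\phi)\|_{\mathbf L_2(\Omega)}\le\hat c\,\|\nabla\phi\|_{\mathbf L_2(\Omega)}\quad\forall\,\phi\in\mathbb V_h(\Omega),$$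 $$\|\mathbf A\nabla u+\widetilde{\mathbf z}(u_{\mathrm{fem}})\|_{\mathbf L_2(\Omega)}\le\hat c_1h^{l-1}\|u\|_{H^l(\Omega)},\quad l=1,2,$$ $$\|\mathrm{div}(\mathbf A\nabla u)+\mathrm{div}\,\widetilde{\mathbf z}(u_{\mathrm{fem}})\|_{L_2(\Omega)}\le\hat c_2\|u\|_{H^2(\Omega)}.$$ Put $c_\dag=\mu_2\,\hat c_{1,2}^{\,2}\,c_\circ^2$. Let $\sigma_*>0$ satisfy $\|u-u_{\mathrm{fem}}\|_{L_2(\Omega)}^2\le\sigma_*^{-1}\|u-u_{\mathrm{fem}}\|_{\mathbf A}^2$ and $\sigma_*^{-1}\le c_\dag h^2$. Then, for any $\sigma\ge0$, $$\mathcal M(\sigma,f,u_{\mathrm{fem}},\widetilde{\mathbf z}(u_{\mathrm{fem}}))\le C\,h^2\,\|f\|_{L_2(\Omega)}^2$$ with a constant $C$ independent of $\sigma$, $h$ and $f$.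
   Context: $\Omega\subset\mathbb R^m$ ($m=2$) is a bounded domain with sufficiently smooth boundary. $\mathbf A=\mathbf A(x)$ is a symmetric $m\times m$ matrix with sufficiently smooth coefficients and $\mu_1\,\xi\cdot\xi\le\mathbf A(x)\xi\cdot\xi\le\mu_2\,\xi\cdot\xi$ for all $x\in\Omega$, $\xi\in\mathbb R^m$, with constants $0<\mu_1,\mu_2$. Notation: $\|\cdot\|_{0,\Omega}$ is the $L_2(\Omega)$ norm and $\|\cdot\|_{k,\Omega}$, $k\ge1$, the $H^k(\Omega)$ norm; $\mathbf L_2(\Omega)=(L_2(\Omega))^m$; $\mathbf H(\Omega,\mathrm{div})=\{\mathbf y\in\mathbf L_2(\Omega):\mathrm{div}\,\mathbf y\in L_2(\Omega)\}$; $\|w\|_{\mathbf A}^2=\int_\Omega\nabla w\cdot\mathbf A\nabla w\,dx$; $]\!|\mathbf y|\![_{\mathbf A^{-1}}^2=\int_\Omega\mathbf A^{-1}\mathbf y\cdot\mathbf y\,dx$. The majorant: for $v\in H^1(\Omega)$ with $v|_{\partial\Omega}=0$, $\mathbf z\in\mathbf H(\Omega,\mathrm{div})$ and the given $\sigma_*>0$, $$\mathcal M(\sigma,f,v,\mathbf z)=\Theta\Big[\,]\!|\mathbf A\nabla v+\mathbf z|\![_{\mathbf A^{-1}}^2+\theta\,\|f-\sigma v-\mathrm{div}\,\mathbf z\|_{L_2(\Omega)}^2\Big],$$ where $\Theta=2/(1+\sigma/\sigma_* )$, $\theta=1/\sigma_*$ if $\sigma\in[0,\sigma_*]$, and $\Theta=1$,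 $\theta=1/\sigma$ if $\sigma>\sigma_*$. Finite element spaces: $\mathbb V_h(\Omega)\subset C(\Omega)\cap H^1(\Omega)$ is induced by an assemblage of (in general curvilinear) finite elements associated with the linear triangular and bilinear square reference elements, and $\mathring{\mathbb V}_h(\Omega)=\{v\in\mathbb V_h(\Omega):v|_{\partial\Omega}=0\}$. The assemblage satisfies the generalized quasiuniformity conditions with mesh parameter $h$: the smooth one-to-one mappings of the reference elements onto the finite elements have partial derivatives of order $|q|\ge1$ (up to the order needed) bounded by $c\,h^{|q|}$ and Jacobian determinants bounded below by $c'h^m$ in absolute value, with $c,c'>0$ independent of the element and of $h$. The finite element solution $u_{\mathrm{fem}}\in\mathring{\mathbb V}_h(\Omega)$ satisfies $\int_\Omega(\mathbf A\nabla u_{\mathrm{fem}}\cdot\nabla\phi+\sigma u_{\mathrm{fem}}\phi)\,dx=\int_\Omega f\phi\,dx$ for all $\phi\in\mathring{\mathbb V}_h(\Omega)$. Constants: $c_\circ$ is the constant, independent of $\sigma\ge 0$ and $f$, in the regularity estimate $\|u\|_{H^2(\Omega)}\le c_\circ\|f\|_{L_2(\Omega)}$ for the weak solution $u$ of $-\mathrm{div}(\mathbf A\nabla u)+\sigma u=f$, $u|_{\partial\Omega}=0$, valid for every $\sigma\ge0$ and $f\in L_2(\Omega)$. $\hat c_{1,2}$ is the constant, independent of $h$, in the interpolation estimate $\|\phi-\phi_{\mathrm{int}}\|_{1,\Omega}\le\hat c_{1,2}\,h\,\|\phi\|_{2,\Omega}$ for $\phi\in H^2(\Omega)$ with $\phi|_{\partial\Omega}=0$,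 where $\phi_{\mathrm{int}}\in\mathring{\mathbb V}_h(\Omega)$ is the finite element interpolant of $\phi$. *)

(* Defs.v *)
From HB Require Import structures.
From mathcomp Require Import all_boot all_order all_algebra.
From mathcomp Require Import all_classical all_reals all_analysis.
Set Implicit Arguments.
Unset Strict Implicit.
Unset Printing Implicit Defensive.
Import Order.TTheory GRing.Theory Num.Theory.
Import numFieldNormedType.Exports.
Local Open Scope classical_set_scope.
Local Open Scope ring_scope.

Notation plane R := (R * R)%type.
Notation sfield R := (R * R -> R)%type.
Notation vfield R := (R * R -> 'cV[R]_2)%type.

Section calculus.
Context {R : realType}.

Definition axis (i : 'I_2) : plane R := if i == 0 then (1, 0) else (0, 1).

Definition coor (i : 'I_2) (x : plane R) : R := if i == 0 then x.1 else x.2.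

Definition pd (i : 'I_2) (f : sfield R) : sfield R :=
  fun x => 'D_(axis i) f x.

(* D^(a,b) = d_1^a d_2^b, for the multi-index (a, b) *)
Definition pderiv (a b : nat) (f : sfield R) : sfield R :=
  iter a (pd 0) (iter b (pd 1) f).

Fixpoint Ck (n : nat) (f : sfield R) : Prop :=
  continuous f /\
  (if n is n'.+1 then
     forall i : 'I_2,
       (forall x, derivable f x (axis i)) /\ Ck n' (pd i f)
   else True).

(* f belongs to C^n of the closure of D: it is the restriction of a C^n
   function on the plane *)
Definition Ck_closure (n : nat) (D : set (plane R)) (f : sfield R) : Prop :=
  exists2 g : sfield R, Ck n g & {in D, f =1 g}.

Definition test_function (D : set (plane R)) (phi : sfield R) : Prop :=
  [/\ forall n, Ck n phi,
      compact (closure [set x | phi x != 0]) &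
      closure [set x | phi x != 0] `<=` D].

Definition planar_domain (D : set (plane R)) : Prop :=
  [/\ D !=set0, open D, connected D & bounded_set D].

(* Near each boundary point, and up to exchanging or reversing the coordinate
   axes, D is the strict epigraph of a C^2 function of one variable. *)
Definition C2_boundary (D : set (plane R)) : Prop :=
  forall x0, (closure D `\` D) x0 ->
    exists (r : R) (g : R -> R) (swap rev : bool),
      [/\ 0 < r,
          (forall t, derivable g t 1) /\ (forall t, derivable (derive1 g) t 1),
          continuous (derive1 (derive1 g)) &
          forall x, ball x0 r x ->
            let: (s, t) := if swap then (x.2, x.1) else (x.1, x.2) in
            D x <-> g s < (-1) ^+ rev * t].

End calculus.

Section spaces.
Context {R : realType}.
Variable D : set (plane R).
Implicit Types (u v f g : sfield R) (y z : vfield R).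

Definition leb2 := (@lebesgue_measure R \x @lebesgue_measure R)%E.

Definition int2 f : R := \int[leb2]_(x in D) f x.

Definition L2 f : Prop :=
  measurable_fun D f /\ leb2.-integrable D (fun x => (f x ^+ 2)%:E).

Definition L2norm f : R := Num.sqrt (int2 (fun x => f x ^+ 2)).

Definition dot (a b : 'cV[R]_2) : R := \sum_(i < 2) a i 0 * b i 0.

Definition vL2 y : Prop := forall i : 'I_2, L2 (fun x => y x i 0).

Definition vL2norm y : R := Num.sqrt (int2 (fun x => dot (y x) (y x))).

Definition is_wderiv (a b : nat) u g : Prop :=
  L2 g /\ forall phi, test_function D phi ->
    int2 (fun x => u x * pderiv a b phi x) =
    (-1) ^+ (a + b) * int2 (fun x => g x * phi x).

(* the weak derivative D^(a,b) u (unique up to a null set), and 0 if u has none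
   in L2 *)
Definition wderiv (a b : nat) u : sfield R :=
  xget (fun=> 0) [set g | is_wderiv a b u g].

Definition Hk (k : nat) u : Prop :=
  L2 u /\ forall a b, (a + b <= k)%N -> exists g, is_wderiv a b u g.

Definition Hnorm (k : nat) u : R :=
  Num.sqrt (L2norm u ^+ 2 +
    \sum_(a < k.+1) \sum_(b < k.+1 | (0 < a + b <= k)%N)
       L2norm (wderiv a b u) ^+ 2).

Definition grad u : vfield R :=
  fun x => \col_i (if i == 0 then wderiv 1 0 u x else wderiv 0 1 u x).

(* functions of H^1 that vanish on the boundary in the sense of traces: the
   closure of the test functions in H^1 *)
Definition H10 u : Prop :=
  Hk 1 u /\ exists phi : nat -> sfield R,
    (forall n, test_function D (phi n)) /\
    (fun n => Hnorm 1 (u \- phi n)) @ \oo --> 0.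

Definition is_wdiv y g : Prop :=
  L2 g /\ forall phi, test_function D phi ->
    int2 (fun x => \sum_(i < 2) y x i 0 * pd i phi x) =
    - int2 (fun x => g x * phi x).

Definition Hdiv y : Prop := vL2 y /\ exists g, is_wdiv y g.

Definition wdiv y : sfield R := xget (fun=> 0) [set g | is_wdiv y g].

End spaces.

Section problem.
Context {R : realType}.
Variables (D : set (plane R)) (A : R * R -> 'M[R]_2).
Implicit Types (u v w f : sfield R) (y z : vfield R).

Definition elliptic_coefficients (mu1 mu2 : R) : Prop :=
  [/\ forall i j : 'I_2, Ck_closure 1 D (fun x => A x i j),
      forall x, D x -> (A x)^T = A x &
      forall x (xi : 'cV[R]_2), D x ->
        mu1 * dot xi xi <= dot (A x *m xi) xi <= mu2 * dot xi xi].

Definition Agrad u : vfield R := fun x => A x *m grad D u x.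

Definition bilin (sigma : R) u v : R :=
  int2 D (fun x => dot (Agrad u x) (grad D v x) + sigma * u x * v x).

Definition weak_solution (sigma : R) f u : Prop :=
  H10 D u /\
  forall phi, H10 D phi -> bilin sigma u phi = int2 D (fun x => f x * phi x).

Definition energy_norm w : R :=
  Num.sqrt (int2 D (fun x => dot (grad D w x) (Agrad w x))).

Definition dual_norm y : R :=
  Num.sqrt (int2 D (fun x => dot (invmx (A x) *m y x) (y x))).

Definition majorant (sstar sigma : R) f v z : R :=
  let Theta := if sigma <= sstar then 2 / (1 + sigma / sstar) else 1 in
  let theta := if sigma <= sstar then sstar^-1 else sigma^-1 in
  Theta * (dual_norm (fun x => Agrad v x + z x) ^+ 2 +
           theta * L2norm D (fun x => f x - sigma * v x - wdiv D z x) ^+ 2).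

(* min[a, sigma^-1], with sigma^-1 = +oo for sigma = 0 *)
Definition min_inv (a sigma : R) : R :=
  if sigma == 0 then a else Num.min a sigma^-1.

End problem.

Section finite_elements.
Context {R : realType}.

Inductive ref_elt := Triangle | Square.

Definition ref_set (e : ref_elt) : set (plane R) :=
  match e with
  | Triangle => [set x | [/\ 0 <= x.1, 0 <= x.2 & x.1 + x.2 <= 1]]
  | Square => [set x | 0 <= x.1 <= 1 /\ 0 <= x.2 <= 1]
  end.

Definition ref_vertices (e : ref_elt) : seq (plane R) :=
  match e with
  | Triangle => [:: (0, 0); (1, 0); (0, 1)]
  | Square => [:: (0, 0); (1, 0); (0, 1); (1, 1)]
  end.

(* linear polynomials on the triangle, bilinear ones on the square *)
Definition ref_shape (e : ref_elt) (p : sfield R) : Prop :=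
  exists a b c d : R,
    (e = Triangle -> d = 0) /\
    forall x, p x = a + b * x.1 + c * x.2 + d * (x.1 * x.2).

(* the segment [a, b] is a vertex (a = b) or an edge of e *)
Definition ref_face (e : ref_elt) (a b : plane R) : Prop :=
  [/\ a \in ref_vertices e, b \in ref_vertices e &
      e = Square -> a.1 = b.1 \/ a.2 = b.2].

Definition seg (a b : plane R) (t : R) : plane R :=
  (a.1 + t * (b.1 - a.1), a.2 + t * (b.2 - a.2)).

Record mesh := Mesh {
  nelt : nat;
  elt_shape : 'I_nelt -> ref_elt;
  emap : 'I_nelt -> plane R -> plane R }.

Definition elt (T : mesh) (r : 'I_(nelt T)) : set (plane R) :=
  emap r @` ref_set (elt_shape r).

(* Distinct elements meet only along common vertices and common edges, and the
   two parametrizations of a common edge agree. *)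
Definition assemblage (D : set (plane R)) (T : mesh) : Prop :=
  closure D = \bigcup_(r in [set: 'I_(nelt T)]) elt r /\
  forall r s : 'I_(nelt T), r != s -> forall x, elt r x -> elt s x ->
    exists a b a' b' : plane R,
      [/\ ref_face (elt_shape r) a b, ref_face (elt_shape s) a' b',
          forall t, 0 <= t <= 1 ->
            emap r (seg a b t) = emap s (seg a' b' t) &
          exists2 t, 0 <= t <= 1 & x = emap r (seg a b t)].

Definition jacobian (chi : plane R -> plane R) (x : plane R) : 'M[R]_2 :=
  \matrix_(i, j) pd j (coor i \o chi) x.

(* Second-order derivatives are the highest ones used with linear and bilinear
   elements; emap is only relevant on the closed reference element, up to
   which it is C^2. *)
Definition regular_mesh (c c' h : R) (T : mesh) : Prop :=
  forall r : 'I_(nelt T),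
    [/\ {in ref_set (elt_shape r) &, injective (emap r)},
        forall i : 'I_2, Ck 2 (coor i \o emap r),
        forall (i : 'I_2) (a b : nat) x, ref_set (elt_shape r) x ->
          (1 <= a + b <= 2)%N ->
          `|pderiv a b (coor i \o emap r) x| <= c * h ^+ (a + b) &
        forall x, ref_set (elt_shape r) x ->
          c' * h ^+ 2 <= `|\det (jacobian (emap r) x)|].

Definition generalized_quasiuniform (D : set (plane R)) (hs : set R)
    (T : R -> mesh) : Prop :=
  exists c c' : R, [/\ 0 < c, 0 < c' &
    forall h, hs h ->
      [/\ 0 < h, assemblage D (T h) & regular_mesh c c' h (T h)]].

Definition Vh (D : set (plane R)) (T : mesh) (v : sfield R) : Prop :=
  [/\ {within D, continuous v}, Hk D 1 v &
      forall r : 'I_(nelt T), exists2 p, ref_shape (elt_shape r) p &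
        forall x, ref_set (elt_shape r) x -> v (emap r x) = p x].

Definition Vh0 (D : set (plane R)) (T : mesh) (v : sfield R) : Prop :=
  Vh D T v /\ H10 D v.

Definition fe_solution (D : set (plane R)) (A : R * R -> 'M[R]_2) (T : mesh)
    (sigma : R) (f u : sfield R) : Prop :=
  Vh0 D T u /\
  forall phi, Vh0 D T phi ->
    bilin D A sigma u phi = int2 D (fun x => f x * phi x).

Definition is_interpolant (D : set (plane R)) (T : mesh) (phi v : sfield R) :
    Prop :=
  Vh0 D T v /\
  forall (r : 'I_(nelt T)) a, a \in ref_vertices (elt_shape r) ->
    v (emap r a) = phi (emap r a).

End finite_elements.
Arguments mesh : clear implicits.

Section constants.
Context {R : realType}.
Variables (D : set (plane R)) (A : R * R -> 'M[R]_2).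

Definition regularity_constant (c : R) : Prop :=
  forall (sigma : R) (f u : sfield R), 0 <= sigma -> L2 D f ->
    weak_solution D A sigma f u ->
    Hk D 2 u /\ Hnorm D 2 u <= c * L2norm D f.

(* Nodal values are those of the continuous representative of phi. *)
Definition interpolation_constant (hs : set R) (T : R -> mesh R) (c : R) : Prop :=
  forall (h : R) (phi phi_int : sfield R), hs h ->
    Hk D 2 phi -> H10 D phi -> {within closure D, continuous phi} ->
    is_interpolant D (T h) phi phi_int ->
    Hnorm D 1 (phi \- phi_int) <= c * h * Hnorm D 2 phi.

(* Z h maps the flux - A grad phi of phi in V_h to the recovered field. *)
Definition recovered (Z : R -> vfield R -> vfield R) (h : R) (phi : sfield R) :
    vfield R :=
  Z h (fun x => - Agrad D A phi x).

End constants.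

(* Main.v *)
(* Young's inequality (a + b)^2 <= 2 (a^2 + b^2) bounds both parts of the
   majorant through quantities controlled by hypothesis.  With e = u - u_fem,
   A grad u_fem + z = (A grad u + z) - A grad e, and, since
   div (A grad u) = sigma u - f, the residual f - sigma u_fem - div z is
   sigma e - (div (A grad u) + div z), where sigma |e| <= |f|.  The factor h^2
   in front of the residual comes from 1 / sigma_* <= c_dag h^2.

   These identities hold almost everywhere only, because weak derivatives are
   chosen by [xget]; they rest on the uniqueness of weak derivatives (the lemma
   of du Bois-Reymond) and on the fact that test functions belong to H^1_0 with
   their classical derivatives as weak derivatives, so that they may be used in
   the weak formulation. *)
Require Import Defs.
From HB Require Import structures.
From mathcomp Require Import all_boot all_order all_algebra.
From mathcomp Require Import all_classical all_reals all_analysis.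
From mathcomp Require Import measurable_realfun ring lra.
Import Order.TTheory GRing.Theory Num.Theory.
Import numFieldNormedType.Exports.
Local Open Scope classical_set_scope.
Local Open Scope ring_scope.
Set Implicit Arguments.
Unset Strict Implicit.
Unset Printing Implicit Defensive.

(** * Measurability in the plane *)

(** Every real integral here is [fine] of an extended one, so each linear manipulation has to be
    paid for with integrability, and each replacement almost everywhere with measurability;
    boundedness of the domain helps, since it puts L^2 inside L^1. The analysis is kept to what
    boxes can carry. The lemma of du Bois-Reymond is reached without mollifiers or density theorems,
    and integration by parts is needed only between two test functions, where it reduces to Fubini's
    theorem and the fundamental theorem of calculus on a line. The dual norm contains the inverse of
    [A x], whose explicit 2 by 2 formula gives measurability. Uniformity in sigma has two sources:
    Theta <= 2 and theta <= 1 / [sstar] in both regimes of the majorant, and sigma |e| <= |f|, which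
    is the second entry of the minimum in the L^2 estimate and costs no regularity of u. *)

Lemma open_bigcup_box (R : realType) (D : set (R * R)) : open D ->
  exists a b c d : nat -> R,
    (forall n, `[a n, b n] `*` `[c n, d n] `<=` D) /\
    D = \bigcup_n (`]a n, b n[ `*` `]c n, d n[).
Proof.
move=> oD.
pose box (q : rat * rat * (rat * rat)) : set (R * R) :=
  `[ratr q.1.1 : R, ratr q.1.2] `*` `[ratr q.2.1 : R, ratr q.2.2].
(* Only boxes whose closed version lies in [D] are kept, so that the closed support of a bump on
   such a box stays inside [D]. Every other index gets the endpoints 1 and 0 in the wrong order,
   that is, an empty box. *)
pose dec n := if unpickle n is Some q then
  if pselect (box q `<=` D) then Some q else None else None.
pose E (s : rat * rat * (rat * rat) -> rat) (z : R) n :=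
  if dec n is Some q then ratr (s q) else z.
exists (E (fun q => q.1.1) 1), (E (fun q => q.1.2) 0),
  (E (fun q => q.2.1) 1), (E (fun q => q.2.2) 0).
have bD n : `[E (fun q => q.1.1) 1 n, E (fun q => q.1.2) 0 n] `*`
    `[E (fun q => q.2.1) 1 n, E (fun q => q.2.2) 0 n] `<=` D.
  rewrite /E /dec; case: unpickle => [q|]; last first.
    move=> [x y] [/=]; rewrite in_itv/= => /andP[x1 x0].
    by have := le_trans x1 x0; rewrite ler10.
  case: pselect => // _ [x y] [/=]; rewrite in_itv/= => /andP[x1 x0].
  by have := le_trans x1 x0; rewrite ler10.
split => //; apply/seteqP; split => [[x y] Dxy|x [n _] [xab xcd]]; last first.
  by apply: (bD n); split; apply: subset_itv_oo_cc.
have /nbhs_ballP[e /= e0 eD] := open_nbhs_nbhs (conj oD Dxy).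
have ratd (t : R) : exists q : rat * rat,
    [/\ t - e < ratr q.1, ratr q.1 < t, t < ratr q.2 & ratr q.2 < t + e].
  have te : t - e < t by rewrite ltrBlDr ltrDl.
  have et : t < t + e by rewrite ltrDl.
  have [q1] := rat_in_itvoo te; rewrite in_itv/= => /andP[? ?].
  by have [q2] := rat_in_itvoo et; rewrite in_itv/= => /andP[? ?]; exists (q1, q2).
have [p [p1 p2 p3 p4]] := ratd x; have [q [q1 q2 q3 q4]] := ratd y.
have pqD : box (p, q) `<=` D.
  move=> [s t] [/=]; rewrite !in_itv/= => /andP[ps sp] /andP[qt tq].
  apply: eD; split; rewrite /= /ball/= ltr_norml.
    by apply/andP; split; lra.
  by apply/andP; split; lra.
exists (pickle (p, q)) => //; rewrite /E.
have -> : dec (pickle (p, q)) = Some (p, q).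
  by rewrite /dec pickleK; case: pselect.
by split => /=; rewrite in_itv/= ?p2 ?p3 ?q2 ?q3.
Qed.

(* [leb2] lives on this type; the measurable structures of [R] and of
   [measurableTypeR R] are convertible but carry different displays, which
   blocks unification. *)
Notation mplane R := (measurableTypeR R * measurableTypeR R)%type.

Lemma open_measurable_plane (R : realType) (D : set (R * R)) :
  open D -> measurable (D : set (mplane R)).
Proof.
move=> /open_bigcup_box[a [b [c [d [_ ->]]]]].
by apply: bigcupT_measurable => n; apply: measurableX.
Qed.

Lemma continuous_measurable_plane (R : realType) (f : R * R -> R) :
  continuous f -> measurable_fun (setT : set (mplane R)) f.
Proof.
move=> /continuousP cf; apply: (measurability _ (RGenOpens.measurableE R)).
move=> _ [_ [a [b ->] <-]]; rewrite setTI; apply: open_measurable_plane.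
by apply: cf; exact: interval_open.
Qed.

(** * Smooth bump functions *)

(* The family [flat c m] is closed under differentiation, up to linear
   combinations, and [flat c 0] tends to the indicator of the positive reals as
   [c] tends to 0. *)
Definition flat {R : realType} (c : R) (m : nat) (t : R) : R :=
  if 0 < t then t^-1 ^+ m * expR (- (c * t^-1)) else 0.

Lemma flat_ge0 (R : realType) (c : R) m t : 0 <= flat c m t.
Proof.
rewrite /flat; case: ifPn => // t0.
by rewrite mulr_ge0 ?expR_ge0// exprn_ge0// invr_ge0 ltW.
Qed.

(** The term of order m + 2 of the exponential series at c / t already beats the negative power of t
    by a factor t^2. This spare square makes the difference quotient at 0 tend to 0. *)
Lemma flat_le_sqr (R : realType) (c : R) m t : 0 < c ->
  flat c m t <= m.+2`!%:R / c ^+ m.+2 * t ^+ 2.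
Proof.
move=> c0; rewrite /flat; case: ifPn => t0; last first.
  by rewrite mulr_ge0 ?sqr_ge0// divr_ge0// exprn_ge0 ?ltW.
have ct0 : 0 <= c * t^-1 by rewrite mulr_ge0 ?invr_ge0 ?ltW.
rewrite expRN ler_pdivrMr ?expR_gt0//.
have h : (c * t^-1) ^+ m.+2 / m.+2`!%:R <= expR (c * t^-1).
  by apply: le_trans (expR_ge1Dxn m.+1 ct0); rewrite lerDr.
apply: le_trans (ler_wpM2l _ h); last first.
  by rewrite mulr_ge0 ?sqr_ge0// divr_ge0// exprn_ge0 ?ltW.
have f0 : m.+2`!%:R != 0 :> R by rewrite pnatr_eq0 -lt0n fact_gt0.
move: (_ `!%:R) f0 => K K0.
rewrite exprMn !exprS le_eqVlt; apply/orP; left; apply/eqP; field.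
by rewrite K0 !gt_eqF// exprn_gt0.
Qed.

Lemma is_derive_flat (R : realType) (c : R) m (t : R) : 0 < c ->
  is_derive t (1 : R) (flat c m) (- m%:R * flat c m.+1 t + c * flat c m.+2 t).
Proof.
move=> c0; have [t0|t0|->] := ltgtP t 0.
- have e : {near t, (cst 0 : R -> R) =1 flat c m}.
    near=> s; rewrite /flat ifN// -leNgt ltW//; near: s.
    exact: lt_nbhsl.
  rewrite /flat !ifN -?leNgt ?ltW// !mulr0 addr0.
  apply: DeriveDef; first by apply: near_eq_derivable e _; exact: derivable_cst.
  by rewrite -(near_eq_derive (1 : R) e) derive_cst.
- pose g s : R := s^-1 ^+ m * expR (- (c * s^-1)).
  have e : {near t, g =1 flat c m}.
    near=> s; rewrite /flat ifT//; near: s.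
    exact: lt_nbhsr.
  have dV : is_derive t (1 : R) (fun s : R => s^-1) (- t ^- 2).
    apply: is_derive_eq (is_deriveV _ (is_derive_id _ _)) _; rewrite ?gt_eqF//.
    by rewrite /= scaler1.
  have dg : is_derive t (1 : R) g (- m%:R * flat c m.+1 t + c * flat c m.+2 t).
    have := is_deriveX m dV; rewrite exprfctE => d1.
    have d2 : is_derive t (1 : R) (fun s : R => expR (- (c * s^-1)))
       (expR (- (c * t^-1)) * (c / t ^+ 2)).
      apply: is_derive1_comp.
      have := is_deriveN (is_deriveZ c dV).
      by rewrite scalerN opprK.
    have d3 : is_derive t (1 : R) g _ := is_deriveM d1 d2.
    apply: (is_derive_eq d3).
    rewrite /flat t0 /= -!exprVn /GRing.scale/=.
    set E := expR _; move: E (t^-1) => E i.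
    by case: m {e g d1 d3} => [|m]; [ring|rewrite /= !exprS -natr1; ring].
  apply: DeriveDef.
    by apply: near_eq_derivable e _; apply: ex_derive.
  by rewrite -(near_eq_derive (1 : R) e) derive_val.
- have f0 n : flat c n 0 = 0 by rewrite /flat ltxx.
  rewrite !f0 !mulr0 addr0.
  have h : h^-1 *: (flat c m (h *: (1 : R) + 0) - flat c m 0) @[h --> 0^'] --> (0:R).
    apply: (@cvg_to_0_linear _ _ (m.+2`!%:R / c ^+ m.+2) 1) => // h /andP[h0 _].
    rewrite f0 subr0 addr0 /GRing.scale/= mulr1 normrM normfV.
    rewrite ler_pdivrMl// ger0_norm ?flat_ge0//.
    move: (_ / _) (flat_le_sqr m h c0) => K hK.
    have := hK; rewrite -[in leRHS]real_normK ?num_real// expr2 mulrCA.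
    exact.
  apply: DeriveDef; first by apply/cvg_ex; exists 0.
  by apply: (cvg_lim _ h).
Unshelve. all: by end_near. Qed.

Section Ck_theory.
Context {R : realType}.
Implicit Types (f g : R * R -> R) (i : 'I_2) (x : R * R).

(** Freezing one variable turns a partial derivative into an ordinary one, to which the chain rule
    and the fundamental theorem of calculus in one variable apply. *)
Definition slice i f x (t : R) : R := f (if i == 0 then (t, x.2) else (x.1, t)).

Lemma axis_shift i x (h : R) :
  h *: axis i + x =
  if i == 0 then (h *: 1 + x.1, x.2) else (x.1, h *: 1 + x.2).
Proof.
case: x => x y; rewrite /axis; case: ifP => _; apply/pair_equal_spec.
  by split => //; rewrite /= scaler0 add0r.
by split => //; rewrite /= scaler0 add0r.
Qed.

Lemma slice_coor i f x : slice i f x (coor i x) = f x.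
Proof. by rewrite /slice /coor; case: x => x y /=; case: (i == 0). Qed.

Lemma slice_axis i f x h : slice i f x (h *: 1 + coor i x) = f (h *: axis i + x).
Proof. by rewrite /slice /coor axis_shift; case: (i == 0). Qed.

Lemma derivable_sliceE i f x :
  derivable f x (axis i) <-> derivable (slice i f x) (coor i x) 1.
Proof.
rewrite /derivable (_ : (fun h : R => h^-1 *: (f (h *: axis i + x) - f x)) =
  (fun h : R => h^-1 *: (slice i f x (h *: (1 : R) + coor i x) - slice i f x (coor i x)))) //.
by apply/funext => h; rewrite slice_axis slice_coor.
Qed.

Lemma pd_sliceE i f x : pd i f x = 'D_1 (slice i f x) (coor i x).
Proof.
rewrite /pd /derive (_ : (fun h : R => h^-1 *: (f (h *: axis i + x) - f x)) =
  (fun h : R => h^-1 *: (slice i f x (h *: (1 : R) + coor i x) - slice i f x (coor i x)))) //.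
by apply/funext => h; rewrite slice_axis slice_coor.
Qed.

Lemma Ck_continuous n f : Ck n f -> continuous f.
Proof. by case: n => [|n] []. Qed.

Lemma CkS n f : Ck n.+1 f -> Ck n f.
Proof.
elim: n f => [|n IHn] f [cf df]; split => // i.
by have [df1 df2] := df i; split => //; apply: IHn.
Qed.

Lemma CkD n f g : Ck n f -> Ck n g -> Ck n (f \+ g).
Proof.
elim: n f g => [|n IHn] f g [cf df] [cg dg]; split => //; try
  by move=> x; apply: continuousD; [exact: cf|exact: cg].
move=> i; have [df1 df2] := df i; have [dg1 dg2] := dg i; split.
  by move=> x; apply: derivableD.
rewrite (_ : pd i _ = pd i f \+ pd i g); first exact: IHn.
by apply/funext => x; rewrite /pd deriveD.
Qed.

Lemma CkM n f g : Ck n f -> Ck n g -> Ck n (f \* g).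
Proof.
elim: n f g => [|n IHn] f g.
  by move=> [cf _] [cg _]; split => // x; apply: continuousM; [exact: cf|exact: cg].
move=> fn gn; have [cf df] := fn; have [cg dg] := gn; split.
  by move=> x; apply: continuousM; [exact: cf|exact: cg].
move=> i; have [df1 df2] := df i; have [dg1 dg2] := dg i; split.
  by move=> x; apply: derivableM.
rewrite (_ : pd i _ = f \* pd i g \+ g \* pd i f).
  by apply: CkD; apply: IHn => //; exact: CkS.
by apply/funext => x; rewrite /pd deriveM.
Qed.

Lemma Ck_cst n (r : R) : Ck n (fun=> r).
Proof.
elim: n r => [|n IHn] r; split => //; try exact: cst_continuous.
move=> i; split => [x|]; first exact: derivable_cst.
by rewrite (_ : pd i _ = fun=> 0)//; apply/funext => x; rewrite /pd derive_cst.
Qed.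

Lemma CkZ n (r : R) f : Ck n f -> Ck n (fun x => r * f x).
Proof. exact: CkM (Ck_cst n r). Qed.

Lemma pd_mul i f g x : derivable f x (axis i) -> derivable g x (axis i) ->
  pd i (f \* g) x = f x * pd i g x + g x * pd i f x.
Proof. by move=> df dg; rewrite /pd deriveM. Qed.

Lemma coor_continuous i : continuous (coor i : R * R -> R).
Proof.
by rewrite /coor; case: (i == 0) => x; [exact: cvg_fst|exact: cvg_snd].
Qed.

Lemma is_derive_slice_flat (c s r : R) i j m x : 0 < c ->
  is_derive (coor j x) (1 : R)
    (slice j (fun x => flat c m (s * coor i x + r)) x)
    (if j == i then s * (- m%:R * flat c m.+1 (s * coor i x + r) +
                         c * flat c m.+2 (s * coor i x + r)) else 0).
Proof.
move=> c0; case: ifPn => [/eqP ->|ji].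
  rewrite (_ : slice _ _ _ = flat c m \o (fun t => s * t + r)); last first.
    by apply/funext => t; rewrite /slice /coor /=; case: (i == 0).
  rewrite mulrC; apply: is_derive1_comp; first exact: is_derive_flat.
  have := is_deriveD (is_deriveZ s (is_derive_id (coor i x) (1 : R)))
    (is_derive_cst r (coor i x) (1 : R)).
  by rewrite addr0 /GRing.scale/= mulr1.
rewrite (_ : slice _ _ _ = cst (flat c m (s * coor i x + r))).
  exact: is_derive_cst.
apply/funext => t; rewrite /slice /coor /cst.
by case: i j ji => [[|[|//]] hi] [[|[|//]] hj].
Qed.

(** The induction on [n] leaves [m] free, because one derivative raises [m] by 1 and by 2. The
    affine argument, with [s] equal to 1 or -1, serves both ends of an interval. *)
Lemma Ck_flat (c s r : R) i m n : 0 < c ->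
  Ck n (fun x => flat c m (s * coor i x + r)).
Proof.
move=> c0; elim: n m => [|n IHn] m.
  split => // x; apply: (@continuous_comp _ _ _ (fun x => s * coor i x + r)).
    apply: continuousD; last exact: cst_continuous.
    by apply: continuousM; [exact: cst_continuous|exact: coor_continuous].
  apply: differentiable_continuous; apply/derivable1_diffP.
  by have := is_derive_flat m (s * coor i x + r) c0.
have cF := Ck_continuous (IHn m); split => // j.
have dF x := is_derive_slice_flat s r i j m x c0.
split => [x|].
  by apply/derivable_sliceE; case: (dF x).
rewrite (_ : pd j _ = (fun x => if j == i
  then s * (- m%:R * flat c m.+1 (s * coor i x + r) +
            c * flat c m.+2 (s * coor i x + r)) else 0)); last first.
  by apply/funext => x; rewrite pd_sliceE; case: (dF x).
case: (j == i); last exact: Ck_cst.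
by apply: CkZ; apply: CkD; apply: CkZ.
Qed.

End Ck_theory.

(** For [e > 0], a smooth function with values in [0, 1] that is positive exactly on the open box;
    it is not flat inside, but tends to 1 there as [e] tends to 0. *)
Definition bump {R : realType} (e a b c d : R) (x : R * R) : R :=
  (flat e 0 (x.1 - a) * flat e 0 (b - x.1)) *
  (flat e 0 (x.2 - c) * flat e 0 (d - x.2)).

Section bump_theory.
Context {R : realType}.
Implicit Types (a b c d e : R) (D : set (R * R)).

Lemma Ck_bump e a b c d n : 0 < e -> Ck n (bump e a b c d).
Proof.
move=> e0.
have h s r i : Ck n (fun x : R * R => flat e 0 (s * coor i x + r)).
  exact: Ck_flat.
have := CkM (CkM (h 1 (- a) 0) (h (- 1) b 0)) (CkM (h 1 (- c) 1) (h (- 1) d 1)).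
congr Ck; apply/funext => x; rewrite /bump /coor /=.
by rewrite !mul1r !mulN1r ![- _ + _]addrC.
Qed.

Lemma flat0_gt0 e (t : R) : (flat e 0 t != 0) = (0 < t).
Proof. by rewrite /flat; case: ifP; rewrite ?eqxx// expr0 mul1r gt_eqF ?expR_gt0. Qed.

Lemma flat0_le1 e (t : R) : 0 < e -> flat e 0 t <= 1.
Proof.
move=> e0; rewrite /flat; case: ifP => // t0.
by rewrite expr0 mul1r -expR0 ler_expR oppr_le0 mulr_ge0 ?invr_ge0 ?ltW.
Qed.

Lemma bump_supp e a b c d :
  [set x | bump e a b c d x != 0] = `]a, b[ `*` `]c, d[.
Proof.
apply/seteqP; split => [[x y]|[x y]] /=;
  rewrite /bump /= !mulf_eq0 !negb_or !flat0_gt0 !subr_gt0 !in_itv/=.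
  by move=> /andP[/andP[-> ->] /andP[-> ->]].
by move=> [/andP[-> ->] /andP[-> ->]].
Qed.

Lemma bump_ge0 e a b c d x : 0 <= bump e a b c d x.
Proof. by rewrite /bump !mulr_ge0 ?flat_ge0. Qed.

Lemma bump_le1 e a b c d x : 0 < e -> bump e a b c d x <= 1.
Proof.
move=> e0; rewrite /bump.
by rewrite !mulr_ile1 ?mulr_ge0 ?flat_ge0 ?flat0_le1.
Qed.

Lemma box_closed a b c d : closed (`[a, b] `*` `[c, d] : set (R * R)).
Proof.
rewrite (_ : _ `*` _ = (fst @^-1` `[a, b]) `&` (snd @^-1` `[c, d])) //.
apply: closedI; apply: closed_comp; try exact: itv_closed.
  by move=> x _; exact: cvg_fst.
by move=> x _; exact: cvg_snd.
Qed.

Lemma test_function_bump D e a b c d : 0 < e -> `[a, b] `*` `[c, d] `<=` D ->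
  test_function D (bump e a b c d).
Proof.
move=> e0 abD.
have cl : closure [set x | bump e a b c d x != 0] `<=` `[a, b] `*` `[c, d].
  rewrite bump_supp closureE; apply: smallest_sub; first exact: box_closed.
  by move=> x [xab xcd]; split; apply: subset_itv_oo_cc.
split; first by move=> n; exact: Ck_bump.
  apply: (subclosed_compact _ _ cl); first exact: closed_closure.
  by apply: compact_setX; exact: segment_compact.
exact: subset_trans cl abD.
Qed.

Lemma cvg_flat0 (t : R) : 0 < t -> flat n.+1%:R^-1 0 t @[n --> \oo] --> (1 : R).
Proof.
move=> t0; rewrite /flat t0.
under eq_fun do rewrite expr0 mul1r.
suff : expR (- (n.+1%:R^-1 * t^-1)) @[n --> \oo] --> expR (- (0 * t^-1)).
  by rewrite mul0r oppr0 expR0.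
apply: continuous_cvg; first exact: continuous_expR.
by apply: cvgN; apply: cvgM; [exact: cvg_harmonic|exact: cvg_cst].
Qed.

Lemma cvg_bump a b c d (x : R * R) :
  bump n.+1%:R^-1 a b c d x @[n --> \oo] --> (\1_(`]a, b[ `*` `]c, d[) x : R).
Proof.
rewrite indicE; have [|xn] := boolP (x \in _).
  rewrite inE /= !in_itv/= => -[/andP[? ?] /andP[? ?]].
  have -> : (true : nat)%:R = (1 * 1) * (1 * 1) :> R by rewrite !mulr1.
  by apply: cvgM; apply: cvgM; apply: cvg_flat0; rewrite subr_gt0.
under eq_fun => n.
  have -> : bump n.+1%:R^-1 a b c d x = 0.
    apply/eqP; apply: contraNT xn => xn.
    by rewrite inE -(bump_supp n.+1%:R^-1).
  over.
exact: cvg_cst.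
Qed.

End bump_theory.

(** * The lemma of du Bois-Reymond *)

(** The sets over whose trace on [Q] the function has zero integral are stable under complement,
    because the integral over [Q] itself vanishes, and under countable disjoint union. Dynkin's
    theorem then passes from a pi-system to the sigma-algebra that it generates. *)
Lemma integral_setI_eq0 d (T : measurableType d) (R : realType)
    (mu : {measure set T -> \bar R}) (G : set (set T)) (Q : set T)
    (f : T -> \bar R) :
  @measurable _ T = <<s G >> -> setI_closed G -> measurable Q ->
  mu.-integrable Q f -> (\int[mu]_(x in Q) f x = 0)%E ->
  (forall A, G A -> \int[mu]_(x in Q `&` A) f x = 0)%E ->
  forall S, measurable S -> (\int[mu]_(x in Q `&` S) f x = 0)%E.
Proof.
move=> GE GI mQ intf fQ0 fG0 S mS.
have mf := measurable_int _ intf.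
apply: (@dynkin_induction _ T G (fun S => \int[mu]_(x in Q `&` S) f x = 0)%E) => //.
- by rewrite setIT.
- move=> A mA fA0; have := fQ0.
  have mQA := measurableI _ _ mQ mA.
  have mQcA := measurableI _ _ mQ (measurableC mA).
  rewrite -[in X in X -> _](setIT Q) -(setUv A) setIUr integral_setU//.
  + by rewrite fA0 add0e.
  + by rewrite -setIUr setUv setIT.
  + by apply/disj_setPS => x [[_ Ax] [_ nAx]].
- move=> F mF tF F0; rewrite setI_bigcupr integral_bigcup.
  + by rewrite eseries0// => n _ _; rewrite F0.
  + by apply: trivIset_setIl.
  + by move=> n; exact: measurableI.
  + rewrite -setI_bigcupr; apply: integrableS intf => //.
    by apply: measurableI => //; exact: bigcupT_measurable.
- by rewrite -GE.
Qed.

Lemma itvoo_setI (R : realType) (a b c d : R) :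
  `]a, b[%classic `&` `]c, d[ = `]Num.max a c, Num.min b d[%classic.
Proof.
apply/seteqP; split=> x /=; rewrite !in_itv/= gt_max lt_min.
  by move=> [/andP[-> ->] /andP[-> ->]].
by move=> /andP[/andP[-> ->] /andP[-> ->]].
Qed.

Definition open_boxes (R : realType) : set (set (R * R)) :=
  [set A | exists a b c d : R, A = `]a, b[ `*` `]c, d[].

Lemma open_boxes_setI (R : realType) : setI_closed (@open_boxes R).
Proof.
move=> _ _ [a [b [c [d ->]]]] [a' [b' [c' [d' ->]]]].
rewrite -setXI !itvoo_setI; do 4 eexists; reflexivity.
Qed.

Lemma bigcup_itvoo (R : realType) : \bigcup_n `](- n%:R : R), n%:R[%classic = setT.
Proof.
apply/seteqP; split => // x _; exists (Num.bound `|x|) => //=.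
by rewrite in_itv/= -ltr_norml; exact: archi_boundP.
Qed.

(** The product sigma-algebra is the least one that makes both projections measurable, so it is
    enough to write a strip over an open interval as a countable union of boxes. *)
Lemma measurable_open_boxes (R : realType) :
  @measurable _ (mplane R) = <<s @open_boxes R >>.
Proof.
apply/seteqP; split; last first.
  apply: smallest_sub; first exact: sigma_algebra_measurable.
  by move=> _ [a [b [c [d ->]]]]; exact: measurableX.
have mbox a b c d : <<s @open_boxes R >> (`]a, b[ `*` `]c, d[).
  by apply: sub_sigma_algebra; do 4 eexists.
pose T := g_sigma_algebraType (@open_boxes R).
have m1 : measurable_fun setT (fst : T -> measurableTypeR R).
  apply: (measurability _ (RGenOpens.measurableE R)).
  move=> _ [_ [a [b ->] <-]]; rewrite setTI.
  rewrite (_ : _ @^-1` _ = \bigcup_n (`]a, b[ `*` `](- n%:R), n%:R[)).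
    by apply: bigcupT_measurable => n; exact: mbox.
  by rewrite -setX_bigcupr bigcup_itvoo setXT.
have m2 : measurable_fun setT (snd : T -> measurableTypeR R).
  apply: (measurability _ (RGenOpens.measurableE R)).
  move=> _ [_ [a [b ->] <-]]; rewrite setTI.
  rewrite (_ : _ @^-1` _ = \bigcup_n (`](- n%:R), n%:R[ `*` `]a, b[)).
    by apply: bigcupT_measurable => n; exact: mbox.
  by rewrite -setX_bigcupl bigcup_itvoo setTX.
apply: smallest_sub; first exact: smallest_sigma_algebra.
rewrite subUset; split => _ [A mA <-]; first exact: m1.
exact: m2.
Qed.

Lemma test_bounded (R : realType) (D : set (R * R)) (phi : R * R -> R) :
  test_function D phi -> exists M, forall x, `|phi x| <= M.
Proof.
move=> [cphi cK KD]; have c := Ck_continuous (cphi 0%N).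
have /compact_bounded[M [Mr HM]] : compact (phi @` closure [set x | phi x != 0]).
  by apply: continuous_compact => //; apply: continuous_subspaceT.
exists (Num.max 0 (M + 1)) => x; rewrite le_max.
have [->|phx] := eqVneq (phi x) 0; first by rewrite normr0 lexx.
apply/orP; right; apply: (HM (M + 1)); first by rewrite ltrDl.
by exists x => //; apply: subset_closure.
Qed.

Lemma test_measurable (R : realType) (D : set (R * R)) (phi : R * R -> R) :
  test_function D phi -> measurable_fun (setT : set (mplane R)) phi.
Proof. by move=> [/(_ 0%N)/Ck_continuous/continuous_measurable_plane]. Qed.

Lemma integrable_test (R : realType) (D : set (R * R)) (f phi : R * R -> R) :
  measurable (D : set (mplane R)) -> leb2.-integrable D (EFin \o f) -> test_function D phi ->
  leb2.-integrable D (EFin \o (fun x => f x * phi x)).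
Proof.
move=> mD fi tphi; have [M hM] := test_bounded tphi.
have mphi : measurable_fun (D : set (mplane R)) phi.
  by apply: measurable_funTS; exact: test_measurable tphi.
rewrite (_ : _ \o _ = ((EFin \o f) \* (EFin \o phi))%E); last first.
  by apply/funext => x /=; rewrite EFinM.
apply: integrableMl => //; exists M; split; first exact: num_real.
by move=> N MN x Dx; apply: le_trans (hM x) (ltW MN).
Qed.

Lemma integral_box_eq0 (R : realType) (D : set (R * R)) (f : R * R -> R)
    (a b c d : R) :
  open D -> leb2.-integrable D (EFin \o f) ->
  (forall phi, test_function D phi -> int2 D (fun x => f x * phi x) = 0) ->
  `[a, b] `*` `[c, d] `<=` D ->
  (\int[leb2]_(x in `]a, b[ `*` `]c, d[) (f x)%:E = 0)%E.
Proof.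
move=> oD fi f0 boxD; have mD := open_measurable_plane oD.
have e0 n : 0 < n.+1%:R^-1 :> R by rewrite invr_gt0.
have tb n := test_function_bump (e0 n) boxD.
pose F n x := (f x * bump n.+1%:R^-1 a b c d x)%:E.
have fF n := integrable_test mD fi (tb n).
(* [fine] sends infinities to 0, so a zero [int2] alone does not make the extended integral zero;
   integrability excludes the infinite values. *)
have F0 n : (\int[leb2]_(x in D) F n x = 0)%E.
  have := f0 _ (tb n); rewrite /int2 /Rintegral => h.
  rewrite -[LHS]fineK ?h//; exact: (integrable_fin_num mD (fF n)).
have mbox : measurable (`]a, b[ `*` `]c, d[ : set (mplane R)).
  exact: measurableX.
have mf := measurable_int _ fi.
pose B : set (mplane R) := `]a, b[ `*` `]c, d[.
have [|||||_ _] := @dominated_convergence _ _ R leb2 D mD F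
  (fun x => (f x * \1_B x)%:E) (abse \o (EFin \o f)).
- by move=> n; apply: measurable_int (fF n).
- apply/measurable_EFinP; apply: measurable_funM; last exact: measurable_indic.
  exact/measurable_EFinP.
- apply: aeW => x Dx; apply: cvg_EFin; first exact: nearW.
  by apply: cvgM; [exact: cvg_cst|exact: cvg_bump].
- exact: integrable_abse.
- apply: aeW => x n Dx; rewrite /F /= lee_fin normrM ler_piMr//.
  by rewrite ger0_norm ?bump_ge0// bump_le1.
rewrite (_ : (fun n => _) = cst 0%E); last by apply/funext.
move=> /(cvg_unique (@ereal_hausdorff R) (cvg_cst 0%E)).
suff -> : (\int[leb2]_(x in D) (f x * \1_B x)%:E =
    \int[leb2]_(x in B) (f x)%:E)%E by move=> <-.
rewrite -[in RHS](@setIidr _ D B); last first.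
  by move=> x [xab xcd]; apply: boxD; split; apply: subset_itv_oo_cc.
rewrite integral_mkcondr; apply: eq_integral => x _.
by rewrite patchE indicE; case: ifP; rewrite ?mulr1 ?mulr0.
Qed.

(* Bumps converge boundedly to the indicators of open boxes, and these boxes
   form a pi-system that generates the Borel sets. *)
Lemma du_bois_reymond (R : realType) (D : set (R * R)) (f : R * R -> R) :
  open D -> leb2.-integrable D (EFin \o f) ->
  (forall phi, test_function D phi -> int2 D (fun x => f x * phi x) = 0) ->
  {ae leb2, forall x, D x -> f x = 0}.
Proof.
move=> oD fi f0; have mD := open_measurable_plane oD.
have [a [b [c [d [boxD DE]]]]] := open_bigcup_box oD.
pose Q n : set (mplane R) := `]a n, b n[ `*` `]c n, d n[.
have mQ n : measurable (Q n) by exact: measurableX.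
have QD n : Q n `<=` D.
  by move=> x [xab xcd]; apply: (boxD n); split; apply: subset_itv_oo_cc.
have fiQ n : leb2.-integrable (Q n) (EFin \o f).
  by apply: integrableS fi.
(* One box at a time: the Dynkin argument needs a zero integral over the whole set, which is known
   for boxes whose closed version lies in [D], but not for [D]. Intersecting such a box with another
   box gives such a box again. *)
have Q0 n : {ae leb2, forall x, Q n x -> f x = 0}.
  have Qf0 S : measurable S -> (\int[leb2]_(x in Q n `&` S) (f x)%:E = 0)%E.
    apply: (integral_setI_eq0 (measurable_open_boxes R) (@open_boxes_setI R)) => //.
      exact: (integral_box_eq0 oD fi f0).
    move=> _ [a' [b' [c' [d' ->]]]]; rewrite /Q -setXI !itvoo_setI.
    apply: (integral_box_eq0 oD fi f0) => x [xab xcd]; apply: (boxD n).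
    move: xab xcd; rewrite /= !in_itv/= !ge_max !le_min.
    by move=> /andP[/andP[-> _] /andP[-> _]] /andP[/andP[-> _] /andP[-> _]].
  have := @integral_ae_eq _ _ _ leb2 (Q n) (mQ n) (cst 0%E) (EFin \o f) (fiQ n).
  move=> /(_ (measurable_cst _)) h.
  have {h} : ae_eq leb2 (Q n) (EFin \o f) (cst 0%E).
    apply: h => E EQ mE; rewrite integral0.
    by rewrite -(setIidr EQ); exact: Qf0.
  by apply: filterS => x /= h Qx; have [] := h Qx.
have /ae_foralln := Q0.
by apply: filterS => x h; rewrite DE => -[n _ Qx]; exact: (h n Qx).
Qed.

(** * Integration by parts *)

Lemma leb2_box_lty (R : realType) (a b c d : R) :
  (leb2 (`[a, b]%classic `*` `[c, d]%classic) < +oo)%E.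
Proof.
have -> : leb2 (`[a, b]%classic `*` `[c, d]%classic) =
    (lebesgue_measure `[a, b] * lebesgue_measure `[c, d])%E.
  by apply: product_measure1E; exact: measurable_itv.
rewrite !lebesgue_measure_itv/=.
by case: ifP => _; case: ifP => _; rewrite ?mule0 ?mul0e ?ltry// -EFinM ltry.
Qed.

(** The vanishing of the derivative cuts the integral down to [-M, M]; the vanishing of [F] removes
    the two boundary terms. *)
Lemma integral_derive_eq0 (R : realType) (F : R -> R) (M : R) : 0 < M ->
  (forall t, derivable F t 1) -> continuous (fun t => 'D_1 F t) ->
  (forall t, M <= `|t| -> F t = 0) -> (forall t, M <= `|t| -> 'D_1 F t = 0) ->
  (\int[lebesgue_measure]_t ('D_1 F t)%:E = 0)%E.
Proof.
move=> M0 dF cF F0 F'0.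
have FC : continuous F.
  by move=> t; apply: differentiable_continuous; apply/derivable1_diffP.
have -> : (\int[lebesgue_measure]_t ('D_1 F t)%:E =
    \int[lebesgue_measure]_(t in `[(- M)%R, M]%classic) ('D_1 F t)%:E)%E.
  rewrite [RHS]integral_mkcond; apply: eq_integral => t _; rewrite patchE.
  case: ifPn => //; rewrite notin_setE /= in_itv/= -ler_norml => /negP.
  by rewrite -ltNge => /ltW /F'0 ->.
rewrite (@continuous_FTC2 _ _ F).
- have -> : F M = 0 by apply: F0; rewrite ger0_norm// ltW.
  have -> : F (- M) = 0 by apply: F0; rewrite normrN ger0_norm// ltW.
  by rewrite subee.
- by rewrite gtrN.
- exact: continuous_subspaceT.
- split => [t _||]; first exact: dF.
    by apply: cvg_at_right_filter; exact: FC.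
  by apply: cvg_at_left_filter; exact: FC.
- by move=> t _; rewrite derive1E.
Qed.

Lemma integrable_compact_support (R : realType) (K : set (R * R)) (f : R * R -> R) :
  compact K -> continuous f -> (forall x, ~ K x -> f x = 0) ->
  leb2.-integrable setT (EFin \o f).
Proof.
move=> cK cf f0; have [M [Mr HM]] := compact_bounded cK.
pose N := `|M| + 1; have MN : M < N by rewrite ltr_pwDr// ler_norm.
pose B : set (mplane R) := `[- N, N] `*` `[- N, N].
have KB : K `<=` B.
  move=> [x y] /(HM _ MN) /=; rewrite prod_normE /= ge_max => /andP[].
  by rewrite !ler_norml => xN yN; split; rewrite /= in_itv.
have mB : measurable B by exact: measurableX.
have -> : EFin \o f = (EFin \o f) \_ B.
  apply/funext => x; rewrite patchE; case: ifPn => //; rewrite notin_setE => nB /=.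
  by rewrite f0// => /KB.
apply/(@integrable_mkcond _ _ _ leb2 B (EFin \o f) mB).
apply: (@measurable_bounded_integrable _ _ _ leb2 f B mB).
- exact: leb2_box_lty.
- by apply: measurable_funTS; exact: continuous_measurable_plane.
have /compact_bounded[C [Cr HC]] : compact (f @` K).
  by apply: continuous_compact => //; apply: continuous_subspaceT.
exists (Num.max 0 C); split; first exact: num_real.
move=> r; rewrite gt_max => /andP[r0 Cr'] x Bx /=.
have [Kx|/f0 ->] := pselect (K x); last by rewrite normr0 ltW.
by apply: (HC r Cr'); exists x.
Qed.

Lemma continuous_pairl (R : realType) (y : R) : continuous (fun s : R => (s, y)).
Proof.
move=> t; exact: (@cvg_pair _ _ _ (nbhs t) (nbhs t) (nbhs y) _ _ _ id (cst y)
  (@cvg_id _ _) (@cvg_cst _ y _ _ _)).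
Qed.

Lemma continuous_pairr (R : realType) (x : R) : continuous (fun s : R => (x, s)).
Proof.
move=> t; exact: (@cvg_pair _ _ _ (nbhs t) (nbhs x) (nbhs t) _ _ _ (cst x) id
  (@cvg_cst _ x _ _ _) (@cvg_id _ _)).
Qed.

Section integration_by_parts.
Context {R : realType}.
Implicit Types (D : set (R * R)) (f g : R * R -> R) (i : 'I_2).

Lemma closure_support0 f x : ~ closure [set x | f x != 0] x ->
  \forall y \near x, f y = 0.
Proof.
move=> nx; have /open_nbhs_nbhs : open_nbhs x (~` closure [set x | f x != 0]).
  by split => //; exact/closed_openC/closed_closure.
apply: filterS => y ny; apply/eqP; apply/negP => /negP fy.
by apply: ny; apply: subset_closure.
Qed.

Lemma pd_support f i x : ~ closure [set x | f x != 0] x -> pd i f x = 0.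
Proof.
move=> /closure_support0 h; rewrite /pd (near_eq_derive (g := cst 0)) ?derive_cst//.
Qed.

(** Fubini's theorem with the differentiated variable innermost: each inner integral is that of the
    derivative of a function of one variable that vanishes outside a bounded interval. *)
Lemma integral_pd_eq0 i f (K : set (R * R)) : Ck 1 f ->
  compact K -> closure [set x | f x != 0] `<=` K ->
  (\int[leb2]_x (pd i f x)%:E = 0)%E.
Proof.
move=> [cf dfi] cK fK; have [df [cdf _]] := dfi i.
have pd0 x : ~ K x -> pd i f x = 0 by move=> nK; apply: pd_support => /fK.
have f0 x : ~ K x -> f x = 0.
  move=> nK; apply/eqP; apply/negP => /negP fx; apply: nK; apply: fK.
  exact: subset_closure.
have fi := integrable_compact_support cK cdf pd0.
have [M [Mr HM]] := compact_bounded cK.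
(* Points of [K] have norm at most |M| + 1; the extra unit puts every point with a coordinate of
   size [N] or more off [K]. *)
pose N := `|M| + 2.
have N0 : 0 < N by rewrite ltr_wpDl.
have KN x y : N <= `|x| \/ N <= `|y| -> ~ K (x, y).
  have MN : M < `|M| + 1 by rewrite ltr_pwDr// ler_norm.
  move=> h /(HM _ MN) /=; rewrite prod_normE /= ge_max => /andP[xM yM].
  by move: h; rewrite /N; case; lra.
have [i0|i0] := eqVneq i 0.
- rewrite -(integral21_prod_meas1 fi); apply: integral0_eq => y _.
  have DE t : 'D_1 (fun s => f (s, y)) t = pd i f (t, y).
    by rewrite pd_sliceE /slice /coor i0.
  rewrite /fubini_G /=.
  under eq_integral => t _ do rewrite -DE.
  apply: (integral_derive_eq0 N0).
  + by move=> t; have /derivable_sliceE := df (t, y); rewrite /slice /coor i0.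
  + rewrite (_ : (fun t => _) = (fun t => pd i f (t, y))); last exact/funext.
    move=> t; apply: (@continuous_comp _ _ _ (fun t => (t, y)) (pd i f)).
      exact: continuous_pairl.
    exact: cdf.
  + by move=> t Nt; apply/f0/KN; left.
  + by move=> t Nt; rewrite DE; apply/pd0/KN; left.
- rewrite -(integral12_prod_meas1 fi); apply: integral0_eq => x _.
  have DE t : 'D_1 (fun s => f (x, s)) t = pd i f (x, t).
    by rewrite pd_sliceE /slice /coor (negbTE i0).
  rewrite /fubini_F /=.
  under eq_integral => t _ do rewrite -DE.
  apply: (integral_derive_eq0 N0).
  + by move=> t; have /derivable_sliceE := df (x, t); rewrite /slice /coor (negbTE i0).
  + rewrite (_ : (fun t => _) = (fun t => pd i f (x, t))); last exact/funext.
    move=> t; apply: (@continuous_comp _ _ _ (fun t => (x, t)) (pd i f)).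
      exact: continuous_pairr.
    exact: cdf.
  + by move=> t Nt; apply/f0/KN; right.
  + by move=> t Nt; rewrite DE; apply/pd0/KN; right.
Qed.

Lemma test_functionM D f g : test_function D f -> test_function D g ->
  test_function D (f \* g).
Proof.
move=> [cf kf fD] [cg kg gD].
have s : closure [set x | (f \* g) x != 0] `<=` closure [set x | f x != 0].
  by apply: closure_subset => x /=; rewrite mulf_eq0 negb_or => /andP[].
split; first by move=> n; exact: CkM.
  by apply: subclosed_compact kf s; exact: closed_closure.
exact: subset_trans s fD.
Qed.

Lemma test_function_pd D f i : test_function D f -> test_function D (pd i f).
Proof.
move=> [cf kf fD].
have s : closure [set x | pd i f x != 0] `<=` closure [set x | f x != 0].
  rewrite [X in X `<=` _]closureE; apply: smallest_sub; first exact: closed_closure.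
  move=> x /=; apply: contra_neqP => nx; exact: pd_support.
split; first by move=> n; have [_ /(_ i)[]] := cf n.+1.
  by apply: subclosed_compact kf s; exact: closed_closure.
exact: subset_trans s fD.
Qed.

Lemma test_function_derivable D f i x : test_function D f -> derivable f x (axis i).
Proof. by move=> [/(_ 1%N)[_ /(_ i)[]]]. Qed.

Lemma int2_pd_eq0 D f i : test_function D f -> int2 D (pd i f) = 0.
Proof.
move=> tf; have [_ kf fD] := tf.
have := integral_pd_eq0 i (let: And3 cf _ _ := tf in cf 1%N) kf (@subset_refl _ _).
rewrite /int2 /Rintegral integral_mkcond => h.
rewrite (_ : _ \_ _ = (fun x => (pd i f x)%:E)) ?h//.
apply/funext => x; rewrite patchE; case: ifPn => //; rewrite notin_setE => nD.
by rewrite pd_support// => /fD.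
Qed.

(** The product of two test functions is a test function, so its partial derivative has zero
    integral; Leibniz's rule splits this integral in two. *)
Lemma int2_by_parts D f g i : open D -> test_function D f -> test_function D g ->
  int2 D (fun x => f x * pd i g x) = - int2 D (fun x => pd i f x * g x).
Proof.
move=> oD tf tg; have mD := open_measurable_plane oD.
have ti h : test_function D h -> leb2.-integrable D (EFin \o h).
  move=> [ch kh hD]; apply: (@integrableS _ _ _ leb2 setT) => //.
  apply: integrable_compact_support kh (Ck_continuous (ch 0%N)) _ => x nx.
  by apply/eqP; apply/negP => /negP hx; apply: nx; exact: subset_closure.
have := int2_pd_eq0 i (test_functionM tf tg).
rewrite (_ : pd i _ = (fun x => f x * pd i g x + pd i f x * g x)).
  rewrite /int2 RintegralD//; first by move/eqP; rewrite addr_eq0 => /eqP.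
    by apply: ti; apply: test_functionM => //; exact: test_function_pd.
  by apply: (ti (pd i f \* g)); apply: test_functionM => //; exact: test_function_pd.
apply/funext => x; rewrite pd_mul;
  [|exact: test_function_derivable tf|exact: test_function_derivable tg].
by rewrite [g x * _]mulrC.
Qed.
End integration_by_parts.

(** * Square-integrable functions *)

Lemma ae_leb2S (R : realType) (P Q : R * R -> Prop) : (forall x, P x -> Q x) ->
  {ae leb2, forall x, P x} -> {ae leb2, forall x, Q x}.
Proof.
move=> PQ; pose mu : {measure set (mplane R) -> \bar R} := @leb2 R.
exact: (@filterS _ (almost_everywhere mu)).
Qed.

Lemma ae_leb2S2 (R : realType) (P Q S : R * R -> Prop) :
  (forall x, P x -> Q x -> S x) ->
  {ae leb2, forall x, P x} -> {ae leb2, forall x, Q x} -> {ae leb2, forall x, S x}.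
Proof.
move=> PQ; pose mu : {measure set (mplane R) -> \bar R} := @leb2 R.
exact: (@filterS2 _ (almost_everywhere mu)).
Qed.

Section L2_theory.
Context {R : realType}.
Variable D : set (R * R).
Hypotheses (oD : open D) (bD : bounded_set D).
Implicit Types (f g u v w : R * R -> R).

Let mD : measurable (D : set (mplane R)) := open_measurable_plane oD.

Lemma bounded_leb2_lty : (leb2 D < +oo)%E.
Proof.
have [M [Mr HM]] := bD; pose N := `|M| + 1.
have MN : M < N by rewrite ltr_pwDr// ler_norm.
apply: le_lt_trans (leb2_box_lty (- N) N (- N) N).
apply: le_measure; rewrite ?inE//; first exact: measurableX.
move=> [x y] /(HM _ MN) /=; rewrite prod_normE /= ge_max => /andP[].
by rewrite !ler_norml => xN yN; split; rewrite /= in_itv.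
Qed.

Lemma L2_measurable f : L2 D f -> measurable_fun (D : set (mplane R)) f.
Proof. by case. Qed.

Lemma bounded_L2 f (M : R) : measurable_fun (D : set (mplane R)) f ->
  (forall x, D x -> `|f x| <= M) -> L2 D f.
Proof.
move=> mf fM; split => //.
apply: (@measurable_bounded_integrable _ _ _ leb2 (fun x => f x ^+ 2) D mD bounded_leb2_lty).
  exact: measurable_funX.
exists (M ^+ 2); split; first exact: num_real.
move=> r Mr x Dx /=; rewrite normrX; apply: le_trans (ltW Mr).
by rewrite lerXn2r ?nnegrE// ?fM// (le_trans _ (fM x Dx)).
Qed.

Lemma L2_cst (r : R) : L2 D (fun=> r).
Proof. by apply: (@bounded_L2 _ `|r|) => //; exact: measurable_cst. Qed.

Lemma L2_integrableM f g : L2 D f -> L2 D g ->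
  leb2.-integrable D (EFin \o (fun x => f x * g x)).
Proof.
move=> [mf fi] [mg gi].
apply: (@le_integrable _ _ _ leb2 D mD _ (fun x => (f x ^+ 2)%:E + (g x ^+ 2)%:E)%E).
- by apply/measurable_EFinP; exact: measurable_funM.
- move=> x Dx; rewrite /= lee_fin normrM [leRHS]ger0_norm ?addr_ge0 ?sqr_ge0//.
  rewrite -(real_normK (num_real (f x))) -(real_normK (num_real (g x))).
  move: `|f x| `|g x| (normr_ge0 (f x)) (normr_ge0 (g x)) => a b a0 b0; nra.
- by apply: integrableD.
Qed.

(** On a bounded domain the constant 1 is square-integrable, and [f] is the product of [f] and 1. *)
Lemma L2_integrable f : L2 D f -> leb2.-integrable D (EFin \o f).
Proof.
move=> /L2_integrableM/(_ (L2_cst 1)).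
by congr integrable; apply/funext => x /=; rewrite mulr1.
Qed.

Lemma L2_boundedM f g (M : R) : measurable_fun (D : set (mplane R)) f ->
  (forall x, D x -> `|f x| <= M) -> L2 D g -> L2 D (fun x => f x * g x).
Proof.
move=> mf fM [mg gi]; split; first exact: measurable_funM.
under eq_fun do rewrite exprMn EFinM.
apply: (@integrableMr _ _ _ leb2 D mD (fun x => f x ^+ 2) (fun x => (g x ^+ 2)%:E)) => //.
  exact: measurable_funX.
exists (M ^+ 2); split; first exact: num_real.
move=> r Mr x Dx /=; rewrite normrX; apply: le_trans (ltW Mr).
by rewrite lerXn2r ?nnegrE// ?fM// (le_trans _ (fM x Dx)).
Qed.

Lemma L2Z (r : R) f : L2 D f -> L2 D (fun x => r * f x).
Proof. by apply: (@L2_boundedM _ _ `|r|) => //; exact: measurable_cst. Qed.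

Lemma L2D f g : L2 D f -> L2 D g -> L2 D (fun x => f x + g x).
Proof.
move=> Lf Lg; have [mf fi] := Lf; have [mg gi] := Lg.
split; first exact: measurable_funD.
have := integrableD mD (integrableD mD fi gi) (L2_integrableM (L2Z 2 Lf) Lg).
congr integrable; apply/funext => x /=; rewrite -!EFinD; congr EFin; ring.
Qed.

Lemma L2B f g : L2 D f -> L2 D g -> L2 D (fun x => f x - g x).
Proof.
move=> Lf Lg; rewrite (_ : (fun _ => _) = (fun x => f x + -1 * g x)).
  by apply: L2D => //; exact: L2Z.
by apply/funext => x; rewrite mulN1r.
Qed.

Lemma test_L2 f : test_function D f -> L2 D f.
Proof.
move=> tf; have [M hM] := test_bounded tf; apply: (@bounded_L2 _ M) => //.
by apply: measurable_funTS; exact: test_measurable tf.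
Qed.

Lemma int2_ae_eq f g : measurable_fun (D : set (mplane R)) f ->
  measurable_fun (D : set (mplane R)) g ->
  {ae leb2, forall x, D x -> f x = g x} -> int2 D f = int2 D g.
Proof.
move=> mf mg fg; rewrite /int2 /Rintegral; congr fine.
apply: (@ae_eq_integral _ _ _ leb2 D) => //; try exact/measurable_EFinP.
by apply: ae_leb2S fg => x h Dx; congr EFin; exact: h.
Qed.

Lemma int2D f g : leb2.-integrable D (EFin \o f) -> leb2.-integrable D (EFin \o g) ->
  int2 D (fun x => f x + g x) = int2 D f + int2 D g.
Proof. exact: RintegralD. Qed.

Lemma int2B f g : leb2.-integrable D (EFin \o f) -> leb2.-integrable D (EFin \o g) ->
  int2 D (fun x => f x - g x) = int2 D f - int2 D g.
Proof. exact: RintegralB. Qed.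

Lemma int2Z (r : R) f : leb2.-integrable D (EFin \o f) ->
  int2 D (fun x => r * f x) = r * int2 D f.
Proof. exact: RintegralZl. Qed.

Lemma int2_sqr_ge0 f : 0 <= int2 D (fun x => f x ^+ 2).
Proof. by apply: Rintegral_ge0 => x _; exact: sqr_ge0. Qed.

Lemma L2norm_sqr f : L2norm D f ^+ 2 = int2 D (fun x => f x ^+ 2).
Proof. by rewrite sqr_sqrtr// int2_sqr_ge0. Qed.

Lemma int2_le f g : leb2.-integrable D (EFin \o f) -> leb2.-integrable D (EFin \o g) ->
  (forall x, D x -> f x <= g x) -> int2 D f <= int2 D g.
Proof. exact: le_Rintegral. Qed.

Lemma L2norm_sqrD f g : L2 D f -> L2 D g ->
  L2norm D (fun x => f x + g x) ^+ 2 <= 2 * (L2norm D f ^+ 2 + L2norm D g ^+ 2).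
Proof.
move=> Lf Lg; rewrite !L2norm_sqr.
have [_ fi] := Lf; have [_ gi] := Lg; have [_ fgi] := L2D Lf Lg.
have fg2 := integrableD mD fi gi.
rewrite -int2D// -int2Z//; apply: int2_le => //.
  by have := integrableZl mD 2 fg2.
move=> x _; rewrite -subr_ge0 (_ : _ - _ = (f x - g x) ^+ 2) ?sqr_ge0//; ring.
Qed.

End L2_theory.

(** * Weak derivatives *)

Lemma sum_order1 (R : nmodType) (F : nat -> nat -> R) :
  \sum_(a < 2) \sum_(b < 2 | (0 < a + b <= 1)%N) F a b = F 0%N 1%N + F 1%N 0%N.
Proof.
rewrite big_ord_recl big_ord1; congr (_ + _).
  by rewrite big_mkcond big_ord_recl big_ord1 /= add0r.
by rewrite big_mkcond big_ord_recl big_ord1 /= addr0.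
Qed.

Section weak_derivatives.
Context {R : realType}.
Variable D : set (R * R).
Hypotheses (oD : open D) (bD : bounded_set D).
Implicit Types (f g u v w phi : R * R -> R) (y z : R * R -> 'cV[R]_2).

Let mD : measurable (D : set (mplane R)) := open_measurable_plane oD.

(** The common source of uniqueness for weak derivatives and weak divergences: both are known only
    through their integrals against test functions. *)
Lemma L2_ae_unique g g' : L2 D g -> L2 D g' ->
  (forall phi, test_function D phi ->
     int2 D (fun x => g x * phi x) = int2 D (fun x => g' x * phi x)) ->
  {ae leb2, forall x, D x -> g x = g' x}.
Proof.
move=> Lg Lg' gg'.
suff h : {ae leb2, forall x, D x -> g x - g' x = 0}.
  by apply: ae_leb2S h => x h Dx; apply/eqP; rewrite -subr_eq0; apply/eqP/h.
apply: du_bois_reymond => //; first by apply: L2_integrable => //; exact: L2B.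
move=> phi tphi; have Lphi := test_L2 oD bD tphi.
under [X in int2 D X]eq_fun do rewrite mulrBl.
rewrite int2B//; try exact: L2_integrableM.
by apply/eqP; rewrite subr_eq0 gg'.
Qed.

Lemma is_wderiv_unique a b u g g' :
  is_wderiv D a b u g -> is_wderiv D a b u g' ->
  {ae leb2, forall x, D x -> g x = g' x}.
Proof.
move=> [Lg ug] [Lg' ug']; apply: L2_ae_unique => // phi tphi.
have := ug phi tphi; rewrite ug'// => /mulfI -> //.
by rewrite signr_eq0.
Qed.

Lemma is_wdiv_unique y g g' : is_wdiv D y g -> is_wdiv D y g' ->
  {ae leb2, forall x, D x -> g x = g' x}.
Proof.
move=> [Lg ug] [Lg' ug']; apply: L2_ae_unique => // phi tphi.
by have := ug phi tphi; rewrite ug'// => /oppr_inj ->.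
Qed.

Lemma wderivP a b u : (exists g, is_wderiv D a b u g) ->
  is_wderiv D a b u (wderiv D a b u).
Proof.
move=> [g ug].
by apply: (xgetPex (fun=> 0) (P := [set g | is_wderiv D a b u g])); exists g.
Qed.

Lemma wdivP y : (exists g, is_wdiv D y g) -> is_wdiv D y (wdiv D y).
Proof.
move=> [g yg].
by apply: (xgetPex (fun=> 0) (P := [set g | is_wdiv D y g])); exists g.
Qed.

Lemma test_function_pderiv a b phi : test_function D phi ->
  test_function D (pderiv a b phi).
Proof.
move=> tphi; rewrite /pderiv.
elim: a => [|a IHa]; last by rewrite iterS; exact: test_function_pd.
by elim: b => [//|b IHb]; rewrite iterS; exact: test_function_pd.
Qed.

Lemma is_wderivB a b u v g g' : L2 D u -> L2 D v ->
  is_wderiv D a b u g -> is_wderiv D a b v g' ->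
  is_wderiv D a b (u \- v) (g \- g').
Proof.
move=> Lu Lv [Lg ug] [Lg' vg']; split; first exact: L2B.
move=> phi tphi; have Lphi := test_L2 oD bD tphi.
have Ldphi := test_L2 oD bD (test_function_pderiv a b tphi).
under [X in int2 D X = _]eq_fun do rewrite /= mulrBl.
under [X in _ = _ * int2 D X]eq_fun do rewrite /= mulrBl.
rewrite !int2B//; try exact: L2_integrableM.
by rewrite mulrBr ug// vg'.
Qed.

Lemma wderivB a b u v : L2 D u -> L2 D v ->
  (exists g, is_wderiv D a b u g) -> (exists g, is_wderiv D a b v g) ->
  {ae leb2, forall x, D x ->
     wderiv D a b (u \- v) x = wderiv D a b u x - wderiv D a b v x}.
Proof.
move=> Lu Lv /wderivP du /wderivP dv.
have duv := is_wderivB Lu Lv du dv.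
exact: is_wderiv_unique (wderivP (ex_intro _ _ duv)) duv.
Qed.

Lemma test_wderiv00 phi : test_function D phi -> is_wderiv D 0 0 phi phi.
Proof. by move=> tphi; split => [|psi _]; [exact: test_L2|rewrite expr0 mul1r]. Qed.

Lemma test_wderiv10 phi : test_function D phi -> is_wderiv D 1 0 phi (pd 0 phi).
Proof.
move=> tphi; split; first by apply: test_L2 => //; exact: test_function_pd.
by move=> psi tpsi; rewrite int2_by_parts// expr1 mulN1r.
Qed.

Lemma test_wderiv01 phi : test_function D phi -> is_wderiv D 0 1 phi (pd 1 phi).
Proof.
move=> tphi; split; first by apply: test_L2 => //; exact: test_function_pd.
by move=> psi tpsi; rewrite int2_by_parts// expr1 mulN1r.
Qed.

Lemma L2norm_ae0 f : L2 D f -> {ae leb2, forall x, D x -> f x = 0} ->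
  L2norm D f = 0.
Proof.
move=> Lf f0; rewrite /L2norm (@int2_ae_eq _ _ oD _ (fun=> 0)).
- by rewrite /int2 Rintegral_cst// mul0r sqrtr0.
- by apply: measurable_funX; exact: L2_measurable.
- exact: measurable_cst.
- by apply: ae_leb2S f0 => x h Dx; rewrite h// expr0n.
Qed.

Lemma is_wderiv_0 a b : is_wderiv D a b (fun=> 0) (fun=> 0).
Proof.
split; first exact: L2_cst.
move=> phi _; under [X in int2 D X = _]eq_fun do rewrite mul0r.
under [X in _ = _ * int2 D X]eq_fun do rewrite mul0r.
by rewrite /int2 Rintegral_cst// mul0r mulr0.
Qed.

(** The chosen weak derivatives of 0 need vanish only almost everywhere, which is enough for their
    norms. This is what lets a test function be approximated in H^1 by the constant sequence equal
    to itself. *)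
Lemma Hnorm_0 k : Hnorm D k (fun=> 0) = 0.
Proof.
rewrite /Hnorm L2norm_ae0; last 2 first.
- exact: L2_cst.
- by apply: aeW.
rewrite expr0n add0r big1 ?sqrtr0// => i _; rewrite big1// => j _.
have w0 := is_wderiv_0 i j; have w := wderivP (ex_intro _ _ w0).
by rewrite L2norm_ae0 ?expr0n//; [case: w|exact: is_wderiv_unique w w0].
Qed.

Lemma test_H10 phi : test_function D phi -> H10 D phi.
Proof.
move=> tphi; split.
  split; first exact: test_L2.
  move=> [|[|a]] [|[|b]]//= _; first by exists phi; exact: test_wderiv00.
    by exists (pd 1 phi); exact: test_wderiv01.
  by exists (pd 0 phi); exact: test_wderiv10.
exists (fun=> phi); split => //.
rewrite (_ : phi \- phi = fun=> 0); last by apply/funext => x /=; rewrite subrr.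
by rewrite Hnorm_0; exact: cvg_cst.
Qed.

Lemma gradE u (i : 'I_2) x :
  grad D u x i 0 = (if i == 0 then wderiv D 1 0 u x else wderiv D 0 1 u x).
Proof. by rewrite mxE. Qed.

Lemma test_grad phi (i : 'I_2) : test_function D phi ->
  {ae leb2, forall x, D x -> grad D phi x i 0 = pd i phi x}.
Proof.
move=> tphi; have [w0 w1] := (test_wderiv10 tphi, test_wderiv01 tphi).
case: i => [[|[|//]] hi].
  apply: ae_leb2S (is_wderiv_unique (wderivP (ex_intro _ _ w0)) w0) => x h Dx.
  by rewrite gradE /= h//; congr (pd _ phi x); exact: val_inj.
apply: ae_leb2S (is_wderiv_unique (wderivP (ex_intro _ _ w1)) w1) => x h Dx.
by rewrite gradE /= h//; congr (pd _ phi x); exact: val_inj.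
Qed.

Lemma Hk1_wderiv u : Hk D 1 u ->
  is_wderiv D 1 0 u (wderiv D 1 0 u) /\ is_wderiv D 0 1 u (wderiv D 0 1 u).
Proof. by move=> [_ hu]; split; apply: wderivP; apply: hu. Qed.

Lemma vL2_grad u : Hk D 1 u -> vL2 D (grad D u).
Proof.
move=> /Hk1_wderiv[[L0 _] [L1 _]] i.
rewrite (_ : (fun x => _) = if i == 0 then wderiv D 1 0 u else wderiv D 0 1 u).
  by case: ifP => _; [exact: L0|exact: L1].
by apply/funext => x; rewrite gradE; case: ifP.
Qed.

Lemma gradB u v (i : 'I_2) : Hk D 1 u -> Hk D 1 v ->
  {ae leb2, forall x, D x ->
     grad D (u \- v) x i 0 = grad D u x i 0 - grad D v x i 0}.
Proof.
move=> [Lu hu] [Lv hv].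
have := @wderivB 1 0 u v Lu Lv (hu _ _ _) (hv _ _ _) => /(_ isT isT) h0.
have := @wderivB 0 1 u v Lu Lv (hu _ _ _) (hv _ _ _) => /(_ isT isT) h1.
have [i0|i1] := boolP (i == 0).
  by apply: ae_leb2S h0 => x h Dx; rewrite !gradE i0 h.
by apply: ae_leb2S h1 => x h Dx; rewrite !gradE (negbTE i1) h.
Qed.

Lemma dotE (a b : 'cV[R]_2) : dot a b = a 0 0 * b 0 0 + a 1 0 * b 1 0.
Proof. by rewrite /dot big_ord_recl big_ord1; congr (_ + a _ _ * b _ _); exact: val_inj. Qed.

Lemma vL2norm_sqr y : vL2norm D y ^+ 2 = int2 D (fun x => dot (y x) (y x)).
Proof.
rewrite sqr_sqrtr//; apply: Rintegral_ge0 => x _.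
by rewrite /= dotE -!expr2 addr_ge0// sqr_ge0.
Qed.

Lemma vL2norm_sqrE y : vL2 D y ->
  vL2norm D y ^+ 2 = L2norm D (fun x => y x 0 0) ^+ 2 + L2norm D (fun x => y x 1 0) ^+ 2.
Proof.
move=> Ly; rewrite vL2norm_sqr !L2norm_sqr -int2D//; first last.
- by case: (Ly 1).
- by case: (Ly 0).
by congr int2; apply/funext => x; rewrite dotE !expr2.
Qed.

Lemma Hnorm_sqr k u : Hnorm D k u ^+ 2 = L2norm D u ^+ 2 +
  \sum_(a < k.+1) \sum_(b < k.+1 | (0 < a + b <= k)%N)
     L2norm D (wderiv D a b u) ^+ 2.
Proof.
rewrite /Hnorm; apply: sqr_sqrtr; apply: addr_ge0; first exact: sqr_ge0.
by apply: sumr_ge0 => i _; apply: sumr_ge0 => j _; exact: sqr_ge0.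
Qed.

Lemma grad_le_Hnorm1 u : Hk D 1 u -> vL2norm D (grad D u) ^+ 2 <= Hnorm D 1 u ^+ 2.
Proof.
move=> hu; rewrite (vL2norm_sqrE (vL2_grad hu)) Hnorm_sqr.
rewrite (_ : (fun x => grad D u x 0 0) = wderiv D 1 0 u); last first.
  by apply/funext => x; rewrite gradE.
rewrite (_ : (fun x => grad D u x 1 0) = wderiv D 0 1 u); last first.
  by apply/funext => x; rewrite gradE.
rewrite (sum_order1 (fun a b => L2norm D (wderiv D a b u) ^+ 2)).
by rewrite [X in _ <= _ + X]addrC lerDr sqr_ge0.
Qed.

End weak_derivatives.

(** * Elliptic coefficients *)

Lemma mulmx2E (R : pzSemiRingType) (M : 'M[R]_2) (y : 'cV[R]_2) i :
  (M *m y) i 0 = M i 0 * y 0 0 + M i 1 * y 1 0.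
Proof.
rewrite mxE big_ord_recl big_ord1.
by congr (_ + M _ _ * y _ _); exact: val_inj.
Qed.

Lemma forall_ord2 (P : 'I_2 -> Prop) : P 0 -> P 1 -> forall i, P i.
Proof.
by move=> P0 P1 [[|[|//]] hi]; [move: P0|move: P1]; congr P; exact: val_inj.
Qed.

Section elliptic.
Context {R : realType}.
Variables (D : set (R * R)) (A : R * R -> 'M[R]_2) (mu1 mu2 : R).
Hypotheses (oD : open D) (bD : bounded_set D).
Hypotheses (mu1_gt0 : 0 < mu1) (ellA : elliptic_coefficients D A mu1 mu2).
Implicit Types (f u v phi : R * R -> R) (y z : R * R -> 'cV[R]_2).

Let mD : measurable (D : set (mplane R)) := open_measurable_plane oD.

Lemma elliptic_sym x : D x -> A x 1 0 = A x 0 1.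
Proof. by case: ellA => _ symA _ /symA {1}<-; rewrite mxE. Qed.

Lemma elliptic_form x (s t : R) : D x ->
  mu1 * (s ^+ 2 + t ^+ 2) <=
    A x 0 0 * s ^+ 2 + 2 * A x 0 1 * s * t + A x 1 1 * t ^+ 2
    <= mu2 * (s ^+ 2 + t ^+ 2).
Proof.
move=> Dx; have [_ _ /(_ x (\col_i (if i == 0 then s else t)) Dx)] := ellA.
rewrite !dotE !mulmx2E !mxE /= (elliptic_sym Dx) -!expr2.
by rewrite (_ : _ * s + _ = A x 0 0 * s ^+ 2 + 2 * A x 0 1 * s * t + A x 1 1 * t ^+ 2)//; ring.
Qed.

(** The form at (1, 0) and (0, 1) bounds the diagonal entries, and the difference of its values at
    (1, 1) and (1, -1) the off-diagonal one. *)
Lemma elliptic_bounded x i j : D x -> `|A x i j| <= mu2.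
Proof.
move=> Dx.
have := elliptic_form 1 0 Dx; have := elliptic_form 0 1 Dx.
have := elliptic_form 1 1 Dx; have := elliptic_form 1 (-1) Dx.
rewrite !(expr1n, expr0n, sqrrN, mulr0, mulr1, addr0, add0r, mulrN)/=.
move=> /andP[h1 h2] /andP[h3 h4] /andP[h5 h6] /andP[h7 h8].
have s := elliptic_sym Dx; have m0 := mu1_gt0; rewrite ler_norml.
by move: i j; apply: forall_ord2; apply: forall_ord2; rewrite ?s;
  apply/andP; split; lra.
Qed.

Definition det2 (x : R * R) : R := A x 0 0 * A x 1 1 - A x 0 1 ^+ 2.

(** With a, d on the diagonal and b off it, the form at (-b, a) equals a (a d - b^2). Ellipticity
    makes this value and a positive. *)
Lemma elliptic_det_gt0 x : D x -> 0 < det2 x.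
Proof.
move=> Dx; have m0 := mu1_gt0.
have /andP[a0 _] := elliptic_form 1 0 Dx.
have /andP[d0 _] := elliptic_form (- A x 0 1) (A x 0 0) Dx.
move: a0 d0; rewrite /det2 !(expr1n, expr0n, sqrrN, mulr0, mulr1, addr0, add0r)/=.
move: (A x 0 0) (A x 0 1) (A x 1 1) => a b d a0 d0.
have {}a0 : 0 < a by lra.
have p : 0 < mu1 * (b ^+ 2 + a ^+ 2).
  by rewrite mulr_gt0// ltr_wpDl ?sqr_ge0// exprn_gt0.
have : 0 < a * (a * d - b ^+ 2) by lra.
by rewrite pmulr_rgt0.
Qed.

Lemma elliptic_unit x : D x -> A x \in unitmx.
Proof.
move=> Dx; have d0 := elliptic_det_gt0 Dx; have s := elliptic_sym Dx.
(* The adjugate of [A x] divided by its determinant. *)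
pose B : 'M[R]_2 := \matrix_(i, j) (if (i == 0) && (j == 0) then A x 1 1 / det2 x
  else if (i == 1) && (j == 1) then A x 0 0 / det2 x else - A x 0 1 / det2 x).
suff /mulmx1_unit[] : A x *m B = 1%:M by [].
apply/matrixP; apply: forall_ord2; apply: forall_ord2;
  rewrite mxE big_ord_recl big_ord1 !mxE /= (_ : lift 0 0 = 1 :> 'I_2) ?s;
  try exact: val_inj; move: d0; rewrite /det2 => d0; field; by rewrite gt_eqF.
Qed.

(** Cramer's rule. A rational expression in the entries of [A x] and [y] is what shows the integrand
    of the dual norm to be measurable. *)
Lemma dot_invmxE x (y : 'cV[R]_2) : D x ->
  dot (invmx (A x) *m y) y =
  (A x 1 1 * y 0 0 ^+ 2 - 2 * A x 0 1 * y 0 0 * y 1 0 + A x 0 0 * y 1 0 ^+ 2) *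
  (det2 x)^-1.
Proof.
move=> Dx; have d0 := elliptic_det_gt0 Dx; have s := elliptic_sym Dx.
have uA := elliptic_unit Dx.
have [w <-] : exists w, A x *m w = y.
  by exists (invmx (A x) *m y); rewrite mulKVmx.
rewrite mulKmx//.
rewrite dotE !mulmx2E s; move: d0; rewrite /det2 => d0; field.
by rewrite gt_eqF.
Qed.

Lemma dot_invmx_ge0 x (y : 'cV[R]_2) : D x -> 0 <= dot (invmx (A x) *m y) y.
Proof.
move=> Dx; have uA := elliptic_unit Dx.
have [w <-] : exists w, A x *m w = y.
  by exists (invmx (A x) *m y); rewrite mulKVmx.
rewrite mulKmx//.
have /andP[h _] := elliptic_form (w 0 0) (w 1 0) Dx.
rewrite dotE !mulmx2E elliptic_sym//.
have : 0 <= mu1 * (w 0 0 ^+ 2 + w 1 0 ^+ 2).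
  by rewrite mulr_ge0 ?addr_ge0 ?sqr_ge0 ?ltW.
lra.
Qed.

(** With y = A w, the difference |A w|^2 - mu1 w . A w is the sum of |A w - mu1 w|^2 and mu1 (w . A
    w - mu1 |w|^2), both nonnegative. No eigenvalues or square roots of matrices enter. *)
Lemma dot_invmx_le x (y : 'cV[R]_2) : D x ->
  dot (invmx (A x) *m y) y <= mu1^-1 * dot y y.
Proof.
move=> Dx; have uA := elliptic_unit Dx; rewrite mulrC ler_pdivlMr// mulrC.
have [w <-] : exists w, A x *m w = y.
  by exists (invmx (A x) *m y); rewrite mulKVmx.
rewrite mulKmx//.
have /andP[h _] := elliptic_form (w 0 0) (w 1 0) Dx.
rewrite !dotE !mulmx2E elliptic_sym//; have m0 := mu1_gt0.
move: (A x 0 0) (A x 0 1) (A x 1 1) (w 0 0) (w 1 0) h => a b d s t h.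
(* [0 <= |A w - mu1 w|^2] and [mu1 |w|^2 <= w . A w] *)
have h1 := sqr_ge0 (a * s + b * t - mu1 * s).
have h2 := sqr_ge0 (b * s + d * t - mu1 * t).
have h3 : 0 <= mu1 * (a * s ^+ 2 + 2 * b * s * t + d * t ^+ 2 - mu1 * (s ^+ 2 + t ^+ 2)).
  by apply: mulr_ge0; [exact: ltW|rewrite subr_ge0].
lra.
Qed.

Lemma elliptic_measurable i j : measurable_fun (D : set (mplane R)) (fun x => A x i j).
Proof.
have [/(_ i j)[g /Ck_continuous cg gA] _ _] := ellA.
apply: (@eq_measurable_fun _ _ (mplane R) R D g); first by move=> x xD; rewrite gA.
by apply: measurable_funTS; exact: continuous_measurable_plane.
Qed.

Lemma measurable_dot_invmx y : vL2 D y ->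
  measurable_fun (D : set (mplane R)) (fun x => dot (invmx (A x) *m y x) (y x)).
Proof.
move=> Ly; have my i : measurable_fun (D : set (mplane R)) (fun x => y x i 0).
  exact: L2_measurable (Ly i).
have mA := elliptic_measurable.
have md : measurable_fun (D : set (mplane R)) det2.
  apply: measurable_funB; first exact: measurable_funM.
  exact: measurable_funX.
(* The real power of exponent -1 is measurable on the whole line, and agrees with the inverse
   because [det2] is positive on [D]. *)
apply: (@eq_measurable_fun _ _ (mplane R) R D (fun x =>
  (A x 1 1 * y x 0 0 ^+ 2 - 2 * A x 0 1 * y x 0 0 * y x 1 0 + A x 0 0 * y x 1 0 ^+ 2) *
  (det2 x `^ (-1)))).
  move=> x /set_mem Dx; rewrite dot_invmxE// powR_inv1//.
  by rewrite ltW// elliptic_det_gt0.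
apply: measurable_funM; last first.
  exact: (measurableT_comp (measurable_powR (-1)) md).
apply: measurable_funD; first apply: measurable_funB.
- by apply: measurable_funM => //; exact: measurable_funX.
- apply: measurable_funM => //; apply: measurable_funM => //.
  by apply: measurable_funM => //; exact: measurable_cst.
- by apply: measurable_funM => //; exact: measurable_funX.
Qed.

Lemma integrable_measurable f : leb2.-integrable D (EFin \o f) ->
  measurable_fun (D : set (mplane R)) f.
Proof. by move=> fi; apply/measurable_EFinP; exact: measurable_int fi. Qed.

Lemma integrable_dot y z : vL2 D y -> vL2 D z ->
  leb2.-integrable D (EFin \o (fun x => dot (y x) (z x))).
Proof.
move=> Ly Lz.
have := integrableD mD (L2_integrableM oD (Ly 0) (Lz 0)) (L2_integrableM oD (Ly 1) (Lz 1)).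
by congr integrable; apply/funext => x; rewrite /= dotE.
Qed.

Lemma dual_norm_le y : vL2 D y -> dual_norm D A y ^+ 2 <= mu1^-1 * vL2norm D y ^+ 2.
Proof.
move=> Ly; rewrite vL2norm_sqr /dual_norm sqr_sqrtr; last first.
  by apply: Rintegral_ge0 => x Dx; exact: dot_invmx_ge0.
have iy := integrable_dot Ly Ly.
have iy1 : leb2.-integrable D (EFin \o (fun x => mu1^-1 * dot (y x) (y x))).
  by have := integrableZl mD mu1^-1 iy.
rewrite -(int2Z oD)//; apply: int2_le => //; last first.
  by move=> x Dx; exact: dot_invmx_le.
apply: (@le_integrable _ _ _ leb2 D mD) iy1.
  by apply/measurable_EFinP; exact: measurable_dot_invmx.
move=> x Dx; rewrite /= lee_fin ger0_norm ?dot_invmx_ge0//.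
by apply: le_trans (dot_invmx_le _ Dx) (ler_norm _).
Qed.

Lemma vL2_Agrad u : Hk D 1 u -> vL2 D (Agrad D A u).
Proof.
move=> /(vL2_grad) hu i; rewrite (_ : (fun x => _) =
  (fun x => A x i 0 * grad D u x 0 0 + A x i 1 * grad D u x 1 0)); last first.
  by apply/funext => x; rewrite /Agrad mulmx2E.
by apply: L2D => //; apply: (@L2_boundedM _ _ oD _ _ mu2) => //;
  try exact: elliptic_measurable; move=> x Dx; exact: elliptic_bounded.
Qed.

(** Entries of size at most mu2 bound the square of each of the two components by 2 mu2^2 |grad
    u|^2, whence the factor 4. *)
Lemma Agrad_le u : Hk D 1 u ->
  vL2norm D (Agrad D A u) ^+ 2 <= 4 * mu2 ^+ 2 * vL2norm D (grad D u) ^+ 2.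
Proof.
move=> hu; have LA := vL2_Agrad hu; have Lg := vL2_grad hu.
rewrite !vL2norm_sqr -(int2Z oD); last exact: integrable_dot.
apply: int2_le => //; first exact: integrable_dot.
  by have := integrableZl mD (4 * mu2 ^+ 2) (integrable_dot Lg Lg).
move=> x Dx; rewrite !dotE !mulmx2E.
have h i j : A x i j ^+ 2 <= mu2 ^+ 2.
  rewrite -(real_normK (num_real (A x i j))) lerXn2r ?nnegrE//.
    exact: le_trans (normr_ge0 _) (elliptic_bounded i j Dx).
  exact: elliptic_bounded.
move: (grad D u x 0 0) (grad D u x 1 0) => s t.
have sq2 (a b : R) : a ^+ 2 <= mu2 ^+ 2 -> b ^+ 2 <= mu2 ^+ 2 ->
    (a * s + b * t) * (a * s + b * t) <= 2 * mu2 ^+ 2 * (s ^+ 2 + t ^+ 2).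
  move=> ha hb.
  have h1 := sqr_ge0 (a * s - b * t).
  have h2 : a ^+ 2 * s ^+ 2 <= mu2 ^+ 2 * s ^+ 2 by rewrite ler_wpM2r ?sqr_ge0.
  have h3 : b ^+ 2 * t ^+ 2 <= mu2 ^+ 2 * t ^+ 2 by rewrite ler_wpM2r ?sqr_ge0.
  lra.
have := sq2 _ _ (h 0 0) (h 0 1); have := sq2 _ _ (h 1 0) (h 1 1); lra.
Qed.

(** Restricted to test functions, the weak formulation is the defining identity of the divergence,
    except that [bilin] contains the chosen weak gradient of [phi] where [is_wdiv] has its classical
    derivatives. The two agree almost everywhere. *)
Lemma weak_solution_is_wdiv sigma f u : L2 D f -> weak_solution D A sigma f u ->
  is_wdiv D (Agrad D A u) (fun x => sigma * u x - f x).
Proof.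
move=> Lf [[hu _] wsol]; have Lu : L2 D u by case: hu.
have Lr : L2 D (fun x => sigma * u x - f x) by apply: L2B => //; exact: L2Z.
have LA := vL2_Agrad hu.
split => // phi tphi; have Hphi := test_H10 oD bD tphi.
have Lphi := test_L2 oD bD tphi.
have Ldphi i : L2 D (pd i phi) by apply: test_L2 => //; exact: test_function_pd.
have Lgphi := vL2_grad Hphi.1.
have iS : leb2.-integrable D (EFin \o (fun x => \sum_(i < 2) Agrad D A u x i 0 * pd i phi x)).
  have := integrableD mD (L2_integrableM oD (LA 0) (Ldphi 0))
    (L2_integrableM oD (LA 1) (Ldphi 1)).
  congr integrable; apply/funext => x; rewrite /= big_ord_recl big_ord1 -EFinD.
  by congr (_ + Agrad _ _ _ _ _ _ * pd _ _ _)%:E; exact: val_inj.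
have iu := L2_integrableM oD (L2Z oD sigma Lu) Lphi.
have := wsol phi Hphi; rewrite /bilin.
rewrite (@int2_ae_eq _ D oD _ (fun x =>
  \sum_(i < 2) Agrad D A u x i 0 * pd i phi x + sigma * u x * phi x)).
- rewrite int2D// => h; apply/eqP; rewrite -subr_eq0 opprK; apply/eqP.
  under [X in _ + int2 D X]eq_fun do rewrite mulrBl.
  by rewrite int2B ?addrA ?h ?subrr//; exact: L2_integrableM.
- by apply: measurable_funD; apply: integrable_measurable => //; exact: integrable_dot.
- by apply: measurable_funD; exact: integrable_measurable.
- apply: ae_leb2S2 (test_grad oD bD 0 tphi) (test_grad oD bD 1 tphi) => x h0 h1 Dx.
  rewrite dotE h0// h1// big_ord_recl big_ord1.
  by congr (_ + Agrad _ _ _ _ _ _ * pd _ _ _ + _); exact: val_inj.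
Qed.

End elliptic.

(** * The majorant *)

(** Meant for the gradients of u, u_fem and e = u - u_fem at a point. The hypotheses are entrywise
    because weak gradients subtract entry by entry, off a null set. *)
Lemma mulmx2B (R : comPzRingType) (M : 'M[R]_2) (a b c : 'cV[R]_2) i :
  c 0 0 = a 0 0 - b 0 0 -> c 1 0 = a 1 0 - b 1 0 ->
  (M *m b) i 0 = (M *m a) i 0 - (M *m c) i 0.
Proof. by rewrite !mulmx2E => -> ->; ring. Qed.

Lemma col_addB (R : ringType) n (a b c z : 'cV[R]_n) i :
  a i 0 = b i 0 - c i 0 -> (a + z) i 0 = (b + z) i 0 - c i 0.
Proof. by move=> h; rewrite !mxE h addrAC. Qed.

Section norms.
Context {R : realType}.
Variable D : set (R * R).
Hypothesis oD : open D.
Implicit Types (f g : R * R -> R) (y p q : R * R -> 'cV[R]_2).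

Lemma L2norm_ae_eq f g : measurable_fun (D : set (mplane R)) f ->
  measurable_fun (D : set (mplane R)) g ->
  {ae leb2, forall x, D x -> f x = g x} -> L2norm D f = L2norm D g.
Proof.
move=> mf mg fg; rewrite /L2norm (@int2_ae_eq _ _ oD _ (fun x => g x ^+ 2))//.
- exact: measurable_funX.
- exact: measurable_funX.
- by apply: ae_leb2S fg => x h Dx; rewrite h.
Qed.

Lemma L2normZ_sqr (r : R) f : L2 D f ->
  L2norm D (fun x => r * f x) ^+ 2 = r ^+ 2 * L2norm D f ^+ 2.
Proof.
move=> [_ fi]; rewrite !L2norm_sqr -(int2Z oD)//.
by congr int2; apply/funext => x; rewrite exprMn.
Qed.

Lemma L2norm_sqrB f g : L2 D f -> L2 D g ->
  L2norm D (fun x => f x - g x) ^+ 2 <= 2 * (L2norm D f ^+ 2 + L2norm D g ^+ 2).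
Proof.
move=> Lf Lg; have := L2norm_sqrD oD Lf (L2Z oD (-1) Lg).
rewrite L2normZ_sqr// sqrrN expr1n mul1r.
by under [fun x => _ + _]eq_fun do rewrite mulN1r.
Qed.

Lemma vL2norm_sqr_le y p q : vL2 D y -> vL2 D p -> vL2 D q ->
  (forall i, {ae leb2, forall x, D x -> y x i 0 = p x i 0 - q x i 0}) ->
  vL2norm D y ^+ 2 <= 2 * (vL2norm D p ^+ 2 + vL2norm D q ^+ 2).
Proof.
move=> Ly Lp Lq ypq.
rewrite (vL2norm_sqrE oD Ly) (vL2norm_sqrE oD Lp) (vL2norm_sqrE oD Lq).
have h i : L2norm D (fun x => y x i 0) ^+ 2 <=
    2 * (L2norm D (fun x => p x i 0) ^+ 2 + L2norm D (fun x => q x i 0) ^+ 2).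
  rewrite (L2norm_ae_eq _ _ (ypq i)).
  - exact: L2norm_sqrB.
  - exact: L2_measurable.
  - by apply: L2_measurable; exact: L2B.
by have := lerD (h 0) (h 1); rewrite -mulrDr addrACA.
Qed.

Lemma L2norm_ge0 f : 0 <= L2norm D f.
Proof. exact: sqrtr_ge0. Qed.

(** Allows an estimate to be squared when its constant has unknown sign: the product on the right is
    nonnegative because it dominates [a]. *)
Lemma sqr_le_mul (a b c : R) : 0 <= a -> a <= b * c -> a ^+ 2 <= b ^+ 2 * c ^+ 2.
Proof. by move=> a0 ab; rewrite -exprMn lerXn2r ?nnegrE// (le_trans a0). Qed.

End norms.
Theorem lemma2p1 (R : realType)
  (Omega : set (R * R)) (A : R * R -> 'M[R]_2) (mu1 mu2 : R)
  (hs : set R) (T : R -> mesh R)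
  (Z : R -> (R * R -> 'cV[R]_2) -> R * R -> 'cV[R]_2)
  (c_reg c_int : R) (c : nat -> nat -> R) (ch ch1 ch2 : R)
  (Omega_domain : planar_domain Omega) (Omega_smooth : C2_boundary Omega)
  (mu1_gt0 : 0 < mu1) (mu2_gt0 : 0 < mu2)
  (A_elliptic : elliptic_coefficients Omega A mu1 mu2)
  (T_quasiuniform : generalized_quasiuniform Omega hs T)
  (c_regP : regularity_constant Omega A c_reg)
  (c_intP : interpolation_constant Omega hs T c_int)
  (convergence : forall (h sigma : R) (f u ufem : R * R -> R),
     hs h -> 0 <= sigma -> L2 Omega f ->
     weak_solution Omega A sigma f u -> fe_solution Omega A (T h) sigma f ufem ->
     forall k l : nat, (k <= 1)%N -> (1 <= l <= 2)%N ->
       Hnorm Omega k (u \- ufem) <= c k l * h ^+ (l - k) * Hnorm Omega l u)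
  (convergence_L2 : forall (h sigma : R) (f u ufem : R * R -> R),
     hs h -> 0 <= sigma -> L2 Omega f ->
     weak_solution Omega A sigma f u -> fe_solution Omega A (T h) sigma f ufem ->
     L2norm Omega (u \- ufem) <=
       min_inv (c_reg * c 0%N 2%N * h ^+ 2) sigma * L2norm Omega f)
  (Z_stable : forall (h : R) (phi : R * R -> R),
     hs h -> Vh Omega (T h) phi ->
     Hdiv Omega (recovered Omega A Z h phi) /\
     vL2norm Omega (recovered Omega A Z h phi) <=
       ch * vL2norm Omega (grad Omega phi))
  (Z_accurate : forall (h sigma : R) (f u ufem : R * R -> R),
     hs h -> 0 <= sigma -> L2 Omega f ->
     weak_solution Omega A sigma f u -> fe_solution Omega A (T h) sigma f ufem ->
     (forall l : nat, (1 <= l <= 2)%N ->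
        vL2norm Omega (fun x => Agrad Omega A u x + recovered Omega A Z h ufem x)
          <= ch1 * h ^+ (l - 1) * Hnorm Omega l u) /\
     L2norm Omega (fun x => wdiv Omega (Agrad Omega A u) x +
                            wdiv Omega (recovered Omega A Z h ufem) x)
       <= ch2 * Hnorm Omega 2 u) :
  exists C : R, forall (h sigma sstar : R) (f u ufem : R * R -> R),
    hs h -> 0 <= sigma -> L2 Omega f ->
    weak_solution Omega A sigma f u -> fe_solution Omega A (T h) sigma f ufem ->
    0 < sstar ->
    L2norm Omega (u \- ufem) ^+ 2 <=
      sstar^-1 * energy_norm Omega A (u \- ufem) ^+ 2 ->
    sstar^-1 <= (mu2 * c_int ^+ 2 * c_reg ^+ 2) * h ^+ 2 ->
    majorant Omega A sstar sigma f ufem (recovered Omega A Z h ufem) <=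
      C * h ^+ 2 * L2norm Omega f ^+ 2.
Proof.
have [_ oD _ bD] := Omega_domain.
(* [K] is c_dag. In [C1], the inverse of mu1 compares the dual norm with the L^2 norm, the outer 2
   is Young's, 4 mu2^2 bounds A grad e by grad e, the constant [c 1 2] is that of the H^1
   convergence estimate, and [c_reg] turns the H^2 norm of u into the norm of f. In [C2], [ch2]
   stands for the divergence error and the summand 1 for sigma e. The leading 2 of the final
   constant bounds Theta. *)
pose K := mu2 * c_int ^+ 2 * c_reg ^+ 2.
pose C1 := mu1^-1 * (2 * (ch1 ^+ 2 + 4 * mu2 ^+ 2 * c 1%N 2%N ^+ 2) * c_reg ^+ 2).
pose C2 := 2 * (ch2 ^+ 2 * c_reg ^+ 2 + 1).
exists (2 * (C1 + K * C2)) => h sigma sstar f u ufem hh sigma0 Lf wsol fesol sstar0 _ sstarK.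
have [[[_ hu1 _] [hufem _]] _] := fesol.
have [[hu _] _] := wsol.
have Lu : L2 Omega u by case: hu.
have Lufem : L2 Omega ufem by case: hufem.
set F := L2norm Omega f.
have F0 : 0 <= F by exact: L2norm_ge0.
set N := Hnorm Omega 2 u.
have N0 : 0 <= N by exact: sqrtr_ge0.
have [_ NF] := c_regP sigma f u sigma0 Lf wsol.
have N2 : N ^+ 2 <= c_reg ^+ 2 * F ^+ 2 by exact: sqr_le_mul.
set e := u \- ufem.
have Le : L2 Omega e by exact: L2B.
have he : Hk Omega 1 e.
  split => // a b ab; have [_ /(_ _ _ ab)[g ug]] := hu.
  have [_ /(_ _ _ ab)[g' ufg']] := hufem.
  by exists (g \- g'); exact: is_wderivB.
have [p1 p2] := Z_accurate h sigma f u ufem hh sigma0 Lf wsol fesol.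
have {}p1 := p1 2%N isT.
set z := recovered Omega A Z h ufem in p1 p2 *.
have [[Lz zdiv] _] : Hdiv Omega z /\ _ := Z_stable h ufem hh fesol.1.1.
have LAu := vL2_Agrad oD mu1_gt0 A_elliptic hu.
have LAufem := vL2_Agrad oD mu1_gt0 A_elliptic hufem.
have LAe := vL2_Agrad oD mu1_gt0 A_elliptic he.
have LD2 y y' : vL2 Omega y -> vL2 Omega y' -> vL2 Omega (fun x => y x + y' x).
  move=> Ly Ly' i; rewrite (_ : (fun x => _) = (fun x => y x i 0 + y' x i 0)).
    exact: L2D.
  by apply/funext => x; rewrite mxE.
have flux : dual_norm Omega A (fun x => Agrad Omega A ufem x + z x) ^+ 2 <= C1 * h ^+ 2 * F ^+ 2.
  apply: le_trans (dual_norm_le oD mu1_gt0 A_elliptic (LD2 _ _ LAufem Lz)) _.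
  rewrite /C1 -!mulrA ler_pM2l ?invr_gt0//.
  have := vL2norm_sqr_le oD (LD2 _ _ LAufem Lz) (LD2 _ _ LAu Lz) LAe.
  move=> /(_ _)/le_trans; apply.
    move=> i.
    apply: ae_leb2S2 (gradB oD bD 0 hu hufem) (gradB oD bD 1 hu hufem) => x h0 h1 Dx.
    apply: col_addB.
    exact: mulmx2B (h0 Dx) (h1 Dx).
  have q1 := sqr_le_mul (sqrtr_ge0 _) p1.
  have q2 := Agrad_le oD mu1_gt0 A_elliptic he.
  have q3 := grad_le_Hnorm1 oD he.
  have q4 := sqr_le_mul (sqrtr_ge0 _)
    (convergence h sigma f u ufem hh sigma0 Lf wsol fesol 1%N 2%N isT isT).
  rewrite subn1 expr1 !exprMn -/N -/e in q1 q4.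
  set m := 4 * mu2 ^+ 2 in q2 *; have m0 : 0 <= m by rewrite mulr_ge0 ?sqr_ge0.
  have q5 : h ^+ 2 * N ^+ 2 <= h ^+ 2 * (c_reg ^+ 2 * F ^+ 2).
    by rewrite ler_wpM2l ?sqr_ge0.
  have q6 := ler_wpM2l m0 (le_trans q3 q4).
  have w0 : 0 <= ch1 ^+ 2 + m * c 1%N 2%N ^+ 2.
    by apply: addr_ge0; [|apply: mulr_ge0 => //]; exact: sqr_ge0.
  have q7 := ler_wpM2l w0 q5.
  rewrite ler_pM2l//; apply: le_trans (lerD q1 (le_trans q2 q6)) _.
  by move: q7; rewrite /m; lra.
have div_u := weak_solution_is_wdiv oD bD mu1_gt0 A_elliptic Lf wsol.
have div_u' := wdivP (ex_intro _ _ div_u).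
have [Lwz _] := wdivP zdiv.
have res : L2norm Omega (fun x => f x - sigma * ufem x - wdiv Omega z x) ^+ 2 <= C2 * F ^+ 2.
  have [Lwu _] := div_u'.
  have Lse : L2 Omega (fun x => sigma * e x) by exact: L2Z.
  have Ls := L2D oD Lwu Lwz.
  rewrite (L2norm_ae_eq oD (g := fun x => sigma * e x -
      (wdiv Omega (Agrad Omega A u) x + wdiv Omega z x))); first last.
  - apply: ae_leb2S (is_wdiv_unique oD bD div_u' div_u) => x hx Dx.
    by rewrite /e /= hx//; ring.
  - by apply: L2_measurable; exact: L2B.
  - by apply: L2_measurable; do 2 apply: L2B => //; exact: L2Z.
  apply: le_trans (L2norm_sqrB oD Lse Ls) _.
  have r1 := sqr_le_mul (sqrtr_ge0 _) p2.
  have r2 : L2norm Omega (fun x => sigma * e x) ^+ 2 <= F ^+ 2.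
    rewrite L2normZ_sqr// -exprMn lerXn2r ?nnegrE ?mulr_ge0 ?L2norm_ge0//.
    have := convergence_L2 h sigma f u ufem hh sigma0 Lf wsol fesol.
    (* For sigma = 0 the term sigma e vanishes; otherwise the second entry of the minimum bounds |e|
       by |f| / sigma. *)
    rewrite /min_inv; case: eqVneq => [->|sn0] le_e; first by rewrite mul0r.
    have s0 : 0 < sigma by rewrite lt_def sn0.
    rewrite -ler_pdivlMl//; apply: le_trans le_e _.
    by rewrite ler_wpM2r// ge_min lexx orbT.
  have r3 := ler_wpM2l (sqr_ge0 ch2) N2.
  rewrite /C2 -mulrA ler_pM2l// mulrDl mul1r addrC -mulrA lerD//.
  exact: le_trans r1 r3.
have Kh0 : 0 <= K * h ^+ 2 by apply: le_trans (ltW _) sstarK; rewrite invr_gt0.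
rewrite /majorant; cbv zeta.
have Theta2 : 0 <= (if sigma <= sstar then 2 / (1 + sigma / sstar) else 1) <= 2.
  case: ifP => _; last by rewrite ler01 ler1n.
  have d1 : 1 <= 1 + sigma / sstar by rewrite lerDl divr_ge0// ltW.
  have d0 : 0 < 1 + sigma / sstar by apply: lt_le_trans d1.
  apply/andP; split; first by apply: divr_ge0 => //; exact: ltW.
  by rewrite ler_pdivrMr// ler_peMr.
(* When sigma exceeds [sstar], 1 / sigma is below 1 / [sstar], so both branches inherit the assumed
   bound c_dag h^2. *)
have theta_le : 0 <= (if sigma <= sstar then sstar^-1 else sigma^-1) <= K * h ^+ 2.
  case: ifPn => [_|]; first by rewrite invr_ge0 ltW.
  rewrite -ltNge => ss; have s0 := lt_trans sstar0 ss.
  rewrite invr_ge0 (ltW s0)/=; apply: le_trans sstarK.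
  by rewrite lef_pV2 ?posrE// ltW.
move: Theta2 theta_le; set Theta := (if _ then 2 / _ else _).
set theta := (if _ then _ else _).
move=> /andP[T0 T2] /andP[t0 tK].
have b0 : 0 <= dual_norm Omega A (fun x => Agrad Omega A ufem x + z x) ^+ 2 by exact: sqr_ge0.
have r0 : 0 <= L2norm Omega (fun x => f x - sigma * ufem x - wdiv Omega z x) ^+ 2.
  exact: sqr_ge0.
have tr : theta * L2norm Omega (fun x => f x - sigma * ufem x - wdiv Omega z x) ^+ 2 <=
    K * h ^+ 2 * (C2 * F ^+ 2) by apply: ler_pM; rewrite ?sqr_ge0.
apply: le_trans (ler_pM T0 _ T2 (lerD flux tr)) _.
  by rewrite addr_ge0// mulr_ge0.
by rewrite le_eqVlt; apply/orP; left; apply/eqP; ring.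
Qed.
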